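(* Let the parameter dimension be $p=1$, let $\alpha\in(0,1)$, and let $z_{1-\alpha}$ be the $(1-\alpha)$-quantile of the standard normal distribution. Assume the regularity conditions (A1)–(A6) and the additional assumption (C) listed in the context. For each $n$ (sufficiently large) let $\theta_{n,1}\in\Theta$ be a solution of the pivot equation $$\sqrt{n}\,B_n(\theta_{n,1})^{-1/2}\,\frac1n\sum_{i=1}^n l_\theta(y_i;\theta_{n,1})=z_{1-\alpha},$$ and let $\theta_{n,2}$ be the solution of the sandwich equation $$\sqrt{n}\,B_n(\hat\theta_n)^{-1/2}A_n(\hat\theta_n)\,(\hat\theta_n-\theta_{n,2})=z_{1-\alpha}.$$ Then $$\sqrt{n}\,|\theta_{n,1}-\theta_{n,2}|\to 0\quad\text{almost surely as } n\to\infty .$$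
   Context: Setting (possibly misspecified likelihood, scalar parameter). The data $y_1,y_2,\dots$ are i.i.d. with true density $g$; the working model is a family of densities $\{f(y;\theta):\theta\in\Theta\}$, $\Theta\subset\mathbb{R}$, and $g$ need not belong to it. All expectations $E$ are with respect to $g$. Write $l(y;\theta)=\log f(y;\theta)$, and $l_\theta$, $l_{\theta\theta}$ for its first and second derivatives in $\theta$. Define $$A_n(\theta)=-\frac1n\sum_{i=1}^n l_{\theta\theta}(y_i;\theta),\quad A(\theta)=-E[l_{\theta\theta}(y;\theta)],\quad B_n(\theta)=\frac1n\sum_{i=1}^n l_\theta(y_i;\theta)^2,\quad B(\theta)=E[l_\theta(y;\theta)^2].$$ $\hat\theta_n$ is a maximizer of $\sum_{i=1}^n l(y_i;\theta)$ over $\Theta$ (the maximum misspecified likelihood estimator). $\theta^*$ is the pseudo-true parameter, i.e. the minimizer over $\Theta$ of the Kullback–Leibler divergence $E[\log g(y)-\log f(y;\theta)]$. Regularity conditions (White, 1982): (A1) the $y_i$ are i.i.d. with a measurable density $g$ with respect to a dominating measure $\nu$ on a measurable Euclidean space; (A2) the densities $f(y;\theta)$ (with respect to $\nu$) are measurable in $y$ for each $\theta\in\Theta$ and continuous in $\theta$ for each $y$, and $\Theta$ is compact; (A3) $E[\log g(y)]$ exists, $|\log f(y;\theta)|\le m(y)$ for all $\theta\in\Theta$ with $m$ integrable under $g$, and the Kullback–Leibler divergence has a unique minimizer $\theta^*\in\Theta$; (A4) $l_\theta(y;\theta)$ is measurable in $y$ for each $\theta$ and continuously differentiable in $\theta$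 for each $y$; (A5) $|l_{\theta\theta}(y;\theta)|$ and $l_\theta(y;\theta)^2$ are bounded, for all $\theta\in\Theta$, by functions of $y$ that are integrable under $g$; (A6) $\theta^*$ is interior to $\Theta$, $B(\theta^* )\neq0$, and $\theta^*$ is a regular point of $A(\theta)$, meaning that $A(\theta)$ has constant rank in an open neighborhood of $\theta^*$. Additional assumption (C): there is a compact convex set $\Theta_{c}\supseteq\Theta$ such that $l(y;\theta)$ is defined and twice continuously differentiable in $\theta$ on $\Theta_c$; the functions $A(\theta)^{-1}$ and $B(\theta)^{1/2}$ and, almost surely for all sufficiently large $n$, $A_n(\theta)^{-1}$ and $B_n(\theta)^{1/2}$, are well defined and continuous on $\Theta_c$; and almost surely $\sup_{\theta\in\Theta_c}|A_n(\theta)^{-1}-A(\theta)^{-1}|\to0$ and $\sup_{\theta\in\Theta_c}|B_n(\theta)^{1/2}-B(\theta)^{1/2}|\to0$. *)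

(* Defs.v *)
From mathcomp Require Export all_boot all_order all_algebra.
From mathcomp Require Export all_classical all_reals all_analysis.

Set Implicit Arguments.
Unset Strict Implicit.
Unset Printing Implicit Defensive.

Import Order.TTheory GRing.Theory Num.Theory.
Import numFieldTopology.Exports numFieldNormedType.Exports.

Local Open Scope classical_set_scope.
Local Open Scope ring_scope.

Section DerivativeOnASet.
Context {R : realType}.
Implicit Types (D : set R) (h : R -> R) (x : R).

(* Difference quotients are restricted to points of D, so that at an endpoint
   of a closed interval D the derivative is one-sided; at an interior point of
   D it is the usual derivative. *)
Definition derivable_on D h x : Prop :=
  cvg ((h z - h x) / (z - x) @[z --> within D x^']).

Definition deriv_on D h x : R :=
  lim ((h z - h x) / (z - x) @[z --> within D x^']).

End DerivativeOnASet.

Definition mutually_independent d d' (W : measurableType d)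
    (T : measurableType d') (R : realType) (P : probability W R)
    (y : nat -> W -> T) : Prop :=
  forall (J : seq nat) (A : nat -> set T),
    uniq J -> (forall i, measurable (A i)) ->
    P (\bigcap_(i in [set` J]) (y i @^-1` A i)) =
    (\prod_(i <- J) P (y i @^-1` A i))%E.

Definition sample_mean (R : realType) (T : Type) (h : T -> R)
    (x : nat -> T) (n : nat) : R :=
  n%:R^-1 * \sum_(i < n) h (x i).

Definition std_normal_quantile (R : realType) (p : R) : R :=
  inf [set x : R | (p%:E <= normal_prob 0 1 `]-oo, x])%E].

(* The observations take values in a measurable subset S of R^k, and the
   densities g and f(.; theta) with respect to nu only matter on S.  The
   log-likelihood only matters for theta in Thetac, the compact convex set on
   which it is assumed to be defined; its theta-derivatives are taken along
   Thetac, so the same l_theta and l_thetatheta serve on Theta and on Thetac. *)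
Section Model.
Context {R : realType} {k : nat}.
Local Notation T := (k.-tuple R).
Context (S : set T) (nu : {measure set T -> \bar R}) (g : T -> R)
        (f : T -> R -> R) (Theta Thetac : set R).
Implicit Types (y : T) (t z : R) (h : T -> R) (x : nat -> T) (n : nat).

Definition loglik y t : R := ln (f y t).

Definition score y t : R := deriv_on Thetac (loglik y) t.

Definition score_deriv y t : R := deriv_on Thetac (score y) t.

Definition integrable_under_g h : Prop :=
  measurable_fun S h /\ nu.-integrable S (fun y => (h y * g y)%:E).

Definition expect_g h : R := \int[nu]_(y in S) (h y * g y).

Definition A_pop t : R := - expect_g (score_deriv ^~ t).

Definition B_pop t : R := expect_g (fun y => score y t ^+ 2).

Definition A_emp x n t : R := - sample_mean (score_deriv ^~ t) x n.

Definition B_emp x n t : R := sample_mean (fun y => score y t ^+ 2) x n.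

(* At points where g vanishes the integrand is 0, i.e. 0 * log 0 = 0. *)
Definition KL_divergence t : R := expect_g (fun y => ln (g y) - loglik y t).

Record iid_with_density d (W : measurableType d) (P : probability W R)
    (y : nat -> {RV P >-> T}) : Prop := {
  sample_space_measurable : measurable S;
  sample_in_space : forall i w, S (y i w);
  sample_independent : mutually_independent P (fun i => y i : W -> T);
  density_measurable : measurable_fun S g;
  density_ge0 : forall u, S u -> 0 <= g u;
  sample_law : forall i (A : set T), measurable A -> A `<=` S ->
    distribution P (y i) A = (\int[nu]_(u in A) (g u)%:E)%E
}.

Record model_densities : Prop := {
  model_measurable : forall t, Theta t -> measurable_fun S (f ^~ t);
  model_ge0 : forall y t, S y -> Theta t -> 0 <= f y t;
  model_mass : forall t, Theta t -> (\int[nu]_(y in S) (f y t)%:E = 1)%E;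
  model_continuous : forall y, S y -> {within Theta, continuous (f y)};
  Theta_compact : compact Theta
}.

(* The library's ln is 0 outside ]0, +oo[, so finiteness of log f has to be
   expressed by the positivity of f. *)
Record loglik_dominated_KL_identified (thetas : R) : Prop := {
  log_density_integrable : integrable_under_g (fun y => ln (g y));
  loglik_dominated : exists m : T -> R, integrable_under_g m /\
    forall y t, S y -> Theta t -> 0 < f y t /\ `|loglik y t| <= m y;
  KL_unique_minimizer :
    [set t | Theta t /\
       forall t', Theta t' -> KL_divergence t <= KL_divergence t'] =
    [set thetas]
}.

Record score_regular : Prop := {
  loglik_derivable : forall y t, S y -> Theta t ->
    derivable_on Thetac (loglik y) t;
  score_measurable : forall t, Theta t -> measurable_fun S (score ^~ t);
  score_derivable : forall y t, S y -> Theta t ->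
    derivable_on Thetac (score y) t;
  score_deriv_continuous : forall y, S y ->
    {within Theta, continuous (score_deriv y)}
}.

Record derivatives_dominated : Prop := {
  score_deriv_dominated : exists m : T -> R, integrable_under_g m /\
    forall y t, S y -> Theta t -> `|score_deriv y t| <= m y;
  score_sq_dominated : exists m : T -> R, integrable_under_g m /\
    forall y t, S y -> Theta t -> score y t ^+ 2 <= m y
}.

Record regular_interior_point (thetas : R) : Prop := {
  thetas_interior : Theta° thetas;
  B_pop_neq0 : B_pop thetas != 0;
  A_pop_constant_rank : \forall t \near thetas,
    \rank ((A_pop t)%:M : 'M[R]_1) = \rank ((A_pop thetas)%:M : 'M[R]_1)
}.

(* "Well defined" means: for A_pop and B_pop, that the expectations exist; for
   an inverse, that the denominator is nonzero. *)
Record uniform_extension d (W : measurableType d) (P : probability W R)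
    (y : nat -> {RV P >-> T}) : Prop := {
  Thetac_compact : compact Thetac;
  Thetac_convex : convex_set (Thetac : set R^o);
  Theta_sub_Thetac : Theta `<=` Thetac;
  loglik_defined : forall u t, S u -> Thetac t -> 0 < f u t;
  loglik_derivable_c : forall u t, S u -> Thetac t ->
    derivable_on Thetac (loglik u) t;
  score_derivable_c : forall u t, S u -> Thetac t ->
    derivable_on Thetac (score u) t;
  score_deriv_continuous_c : forall u, S u ->
    {within Thetac, continuous (score_deriv u)};
  A_pop_defined : forall t, Thetac t ->
    integrable_under_g (score_deriv ^~ t) /\ A_pop t != 0;
  A_pop_inv_continuous : {within Thetac, continuous (fun t => (A_pop t)^-1)};
  B_pop_defined : forall t, Thetac t ->
    integrable_under_g (fun u => score u t ^+ 2);
  B_pop_sqrt_continuous :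
    {within Thetac, continuous (fun t => Num.sqrt (B_pop t))};
  empirical_defined_continuous : {ae P, forall w, \forall n \near \oo,
    [/\ forall t, Thetac t -> A_emp (y ^~ w) n t != 0,
        {within Thetac, continuous (fun t => (A_emp (y ^~ w) n t)^-1)} &
        {within Thetac, continuous (fun t => Num.sqrt (B_emp (y ^~ w) n t))}]};
  A_inv_uniform_cvg : {ae P, forall w,
    ereal_sup [set (`|(A_emp (y ^~ w) n t)^-1 - (A_pop t)^-1|)%:E
              | t in Thetac] @[n --> \oo] --> 0%E};
  B_sqrt_uniform_cvg : {ae P, forall w,
    ereal_sup [set (`|Num.sqrt (B_emp (y ^~ w) n t) - Num.sqrt (B_pop t)|)%:E
              | t in Thetac] @[n --> \oo] --> 0%E}
}.

Definition is_max_likelihood x n t : Prop :=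
  Theta t /\ forall t', Theta t' ->
    \sum_(i < n) loglik (x i) t' <= \sum_(i < n) loglik (x i) t.

(* In the two equations below, B_emp != 0 says that the factor B_emp^(-1/2) is
   meaningful, the library's inverse of 0 being 0. *)
Definition solves_pivot_equation z x n t : Prop :=
  [/\ Theta t, B_emp x n t != 0 &
      Num.sqrt n%:R * (Num.sqrt (B_emp x n t))^-1 *
        sample_mean (score ^~ t) x n = z].

Definition solves_sandwich_equation z x n (that t : R) : Prop :=
  B_emp x n that != 0 /\
  Num.sqrt n%:R * (Num.sqrt (B_emp x n that))^-1 * A_emp x n that *
    (that - t) = z.

End Model.

(* Main.v *)
From HB Require Import structures.
Require Import Defs.
From mathcomp Require Import measurable_realfun ring lra zify.
Import Order.TTheory GRing.Theory Num.Theory.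
Import numFieldTopology.Exports numFieldNormedType.Exports.
Local Open Scope classical_set_scope.
Local Open Scope ring_scope.

Set Implicit Arguments.
Unset Strict Implicit.
Unset Printing Implicit Defensive.

(** Write S_n for the mean score, so that S_n' = - A_n on Thetac.  Comparing
second difference quotients of the expected log-likelihood at its interior
maximum thetas gives A(thetas) >= 0, hence A > 0 on the interval Thetac since
1/A is continuous and does not vanish; uniform convergence then bounds A_n away
from 0 and oo.  The score at thetas is centered and square integrable, so
S_n(thetas) -> 0 almost surely.  As S_n is strictly decreasing with slope
bounded away from 0, both the pivot solution theta1 (where S_n = O(n^(-1/2)))
and the maximizer thetahat tend to thetas; thetahat is therefore eventually
interior and S_n(thetahat) = 0.  The mean value theorem now gives, for some xi
between theta1 and thetahat,
  sqrt n (theta1 - theta2) =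
    z (B_n(thetahat)^(1/2) / A_n(thetahat) - B_n(theta1)^(1/2) / A_n(xi)),
and both quotients converge to B(thetas)^(1/2) / A(thetas). *)

(** * Derivatives relative to an interval *)

(** Naming the limit [l] makes sums and scalings easy to state. With [l := deriv_on D h x] this
    unfolds to [derivable_on D h x], since [cvg] means convergence to [lim]. *)
Definition has_deriv_on (R : realType) (D : set R) (h : R -> R) (x l : R) :=
  (h z - h x) / (z - x) @[z --> within D x^'] --> l.

(** Multiplying by [|z - x|] removes the quotient; the resulting first-order expansion is trivial at
    [z = x], so the puncture of the filter disappears. *)
Lemma has_deriv_onP (R : realType) (D : set R) (h : R -> R) (x l : R) :
  has_deriv_on D h x l <-> forall e, 0 < e -> exists2 r, 0 < r &
    forall z, D z -> `|z - x| < r -> `|h z - h x - l * (z - x)| <= e * `|z - x|.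
Proof.
split=> [/cvgrPdist_le H e e0|H].
  have /nbhs_ballP[r /= r0 rH] := H e e0.
  exists r => // z Dz zr; have [->|zx] := eqVneq z x.
    by rewrite !subrr mulr0 subr0 normr0 mulr0.
  have zx0 : z - x != 0 by rewrite subr_eq0.
  have := rH z; rewrite -ball_normE /= distrC => /(_ zr zx Dz).
  rewrite -(ler_pM2r (_ : 0 < `|z - x|)) ?normr_gt0// -normrM => hle.
  rewrite distrC; apply: le_trans hle.
  by rewrite mulrBl divfK// distrC.
apply/cvgrPdist_le => e e0; have [r r0 rH] := H e e0.
apply/nbhs_ballP; exists r => //= z; rewrite -ball_normE /= distrC => zr zx Dz.
have zx0 : z - x != 0 by rewrite subr_eq0.
rewrite -(ler_pM2r (_ : 0 < `|z - x|)) ?normr_gt0// -normrM mulrBl divfK//.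
by rewrite distrC; exact: rH.
Qed.

Lemma has_deriv_on_sum (R : realType) (D : set R) (n : nat)
    (h : 'I_n -> R -> R) (dh : 'I_n -> R) (x : R) :
  (forall i, has_deriv_on D (h i) x (dh i)) ->
  has_deriv_on D (fun t => \sum_i h i t) x (\sum_i dh i).
Proof.
move=> H; rewrite /has_deriv_on.
have -> : (fun z : R => (\sum_i h i z - \sum_i h i x) / (z - x)) =
  (fun z => \sum_i ((h i z - h i x) / (z - x))).
  by apply/funext => z; rewrite -sumrB mulr_suml.
by apply: cvg_big => [|i _]; [exact: add_continuous|exact: H].
Qed.

Lemma has_deriv_onZ (R : realType) (D : set R) (c : R) (h : R -> R) (x l : R) :
  has_deriv_on D h x l -> has_deriv_on D (fun t => c * h t) x (c * l).
Proof.
move=> H; rewrite /has_deriv_on.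
under eq_fun do rewrite -mulrBr -mulrA.
exact: cvgMr.
Qed.

(** A small ball around an interior point lies in [D], so the restriction to [D] is void there. This
    gives access to the classical results on derivatives. *)
Lemma has_deriv_on_is_derive (R : realType) (D : set R) (h : R -> R) (x l : R) :
  D° x -> has_deriv_on D h x l -> is_derive x 1 h l.
Proof.
move=> /nbhs_ballP[r0 /= r00 Dr] /has_deriv_onP H.
suff C : (fun k : R => k^-1 *: (h (k *: (1 : R) + x) - h x)) @ 0^' --> l.
  apply: DeriveDef; first by apply/cvg_ex; exists l.
  exact: cvg_lim C.
apply/cvgrPdist_le => e e0; have [r rp rH] := H e e0.
apply/nbhs_ballP; exists (Num.min r r0); first by rewrite /= lt_min rp.
move=> k; rewrite -ball_normE /= sub0r normrN lt_min => /andP[kr kr0] k0.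
have := rH (k + x); rewrite addrK => /(_ _ kr) hh.
rewrite scaler1 -(ler_pM2r (_ : 0 < `|k|)) ?normr_gt0// -normrM mulrBl.
rewrite [_ *: _]mulrC divfK// distrC; apply: hh; apply: Dr.
by rewrite -ball_normE /= opprD addrA [x - k]addrC addrK normrN.
Qed.

Lemma itvoo_interior (R : realType) (D : set R) (a b x : R) :
  `[a, b] `<=` D -> x \in `]a, b[ -> D° x.
Proof.
move=> abD xab; rewrite /interior /=.
have : nbhs x `]a, b[%classic by apply: open_nbhs_nbhs; split => //; exact: itv_open.
apply: filterS => y yab; apply: abD; exact: subset_itv_oo_cc yab.
Qed.

Lemma has_deriv_on_MVT (R : realType) (D : set R) (h dh : R -> R) (a b : R) :
  a < b -> `[a, b] `<=` D -> (forall x, D x -> has_deriv_on D h x (dh x)) ->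
  exists2 c, c \in `]a, b[ & h b - h a = dh c * (b - a).
Proof.
move=> ab abD H; apply: MVT => // [x xab|].
  apply: has_deriv_on_is_derive (itvoo_interior abD xab) (H _ _).
  by apply: abD; exact: subset_itv_oo_cc xab.
apply/subspace_continuousP => x xab; apply/cvgrPdist_le => e e0.
(* The expansion with tolerance 1 gives [|h z - h x| <= (|dh x| + 1) * |z - x|] near [x], hence
   continuity on the closed interval, endpoints included. *)
have /has_deriv_onP/(_ 1 ltr01)[r r0 rH] := H x (abD _ xab).
pose s := Num.min r (e / (`|dh x| + 1)).
have dp : 0 < `|dh x| + 1 by rewrite ltr_wpDl.
apply/nbhs_ballP; exists s; first by rewrite /s /= lt_min r0 divr_gt0.
move=> z; rewrite -ball_normE /= distrC lt_min => /andP[zr ze] zab.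
have := rH z (abD _ zab) zr; rewrite mul1r => hz.
rewrite distrC; apply: (@le_trans _ _ ((`|dh x| + 1) * `|z - x|)).
  rewrite -[h z - h x](subrK (dh x * (z - x))).
  by rewrite (le_trans (ler_normD _ _))// normrM mulrDl mul1r addrC lerD2l.
by rewrite mulrC -ler_pdivlMr// ltW.
Qed.

(** A form of the mean value theorem free of the order of [x] and [y]. The distance bound is what
    later forces intermediate points to converge. *)
Lemma has_deriv_on_MVT_dist (R : realType) (D : set R) (h dh : R -> R) (x y : R) :
  is_interval D -> D x -> D y -> (forall x, D x -> has_deriv_on D h x (dh x)) ->
  exists c, [/\ D c, `|c - x| <= `|y - x| & h y - h x = dh c * (y - x)].
Proof.
move=> iD Dx Dy H.
have sub a b : D a -> D b -> `[a, b] `<=` D.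
  by move=> Da Db z; rewrite /= in_itv /= => zab; exact: iD zab.
have [xy|yx|->] := ltgtP x y.
- have [c cxy e] := has_deriv_on_MVT xy (sub _ _ Dx Dy) H.
  exists c; split => //; first exact: (sub _ _ Dx Dy) (subset_itv_oo_cc cxy).
  move: cxy; rewrite in_itv /= => /andP[xc cy].
  by rewrite !ger0_norm ?subr_ge0 ?(ltW xc) ?(ltW xy)// lerD2r ltW.
- have [c cxy e] := has_deriv_on_MVT yx (sub _ _ Dy Dx) H.
  exists c; split => //; first exact: (sub _ _ Dy Dx) (subset_itv_oo_cc cxy).
    move: cxy; rewrite in_itv /= => /andP[xc cy].
    by rewrite !ler0_norm ?subr_le0 ?(ltW cy) ?(ltW yx)// lerN2 lerD2r ltW.
  by rewrite -opprB e -mulrN opprB.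
- by exists y; split => //; rewrite !subrr mulr0.
Qed.

(** The first-order remainder is exactly [b * (z - x) ^+ 2]. These polynomials are the Taylor
    polynomials subtracted in the two second-order lemmas below. *)
Lemma has_deriv_on_quadratic (R : realType) (D : set R) (a b t x : R) :
  has_deriv_on D (fun z => a * (z - t) + b * (z - t) ^+ 2) x (a + b * 2 * (x - t)).
Proof.
apply/has_deriv_onP => e e0; exists (e / (`|b| + 1)) => [|z _ zx].
  by rewrite divr_gt0// ltr_wpDl.
have -> : a * (z - t) + b * (z - t) ^+ 2 - (a * (x - t) + b * (x - t) ^+ 2) -
   (a + b * 2 * (x - t)) * (z - x) = b * (z - x) * (z - x) by ring.
rewrite normrM ler_wpM2r// normrM.
apply: (@le_trans _ _ ((`|b| + 1) * `|z - x|)).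
  by rewrite ler_wpM2r// lerDl.
by rewrite mulrC -ler_pdivlMr ?ltr_wpDl// ltW.
Qed.

Lemma has_deriv_onB (R : realType) (D : set R) (f h : R -> R) (x a b : R) :
  has_deriv_on D f x a -> has_deriv_on D h x b ->
  has_deriv_on D (fun z => f z - h z) x (a - b).
Proof.
move=> fa hb; rewrite /has_deriv_on.
have -> : (fun z : R => (f z - h z - (f x - h x)) / (z - x)) =
  (fun z => (f z - f x) / (z - x) - (h z - h x) / (z - x)).
  by apply/funext => z; rewrite -mulrBl; congr (_ / _); ring.
exact: cvgB.
Qed.

(** The mean value theorem is used twice: for [l] minus its tangent at [t], then for [s] between [t]
    and the intermediate point. This provides the dominating function for second-order quotients. *)
Lemma second_order_bound (R : realType) (D : set R) (l s ds : R -> R) (t m h : R) :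
  0 < h -> `[t, t + h] `<=` D ->
  (forall x, D x -> has_deriv_on D l x (s x)) ->
  (forall x, D x -> has_deriv_on D s x (ds x)) ->
  (forall x, x \in `[t, t + h] -> `|ds x| <= m) ->
  `|l (t + h) - l t - s t * h| <= m * h ^+ 2.
Proof.
move=> h0 hD dl dds dsm.
(* The zero quadratic coefficient lets [has_deriv_on_quadratic] cover the tangent line. *)
pose k x := l x - (s t * (x - t) + 0 * (x - t) ^+ 2).
have dk x : D x -> has_deriv_on D k x (s x - (s t + 0 * 2 * (x - t))).
  by move=> Dx; exact: has_deriv_onB (dl _ Dx) (@has_deriv_on_quadratic _ D _ _ t x).
have th : t < t + h by rewrite ltrDl.
have [c] := has_deriv_on_MVT th hD dk.
rewrite in_itv /= => /andP[tc cth].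
have -> : k (t + h) - k t = l (t + h) - l t - s t * h by rewrite /k; ring.
move=> ->.
have sub : `[t, c] `<=` D.
  move=> x; rewrite /= in_itv /= => /andP[x1 x2]; apply: hD => /=.
  by rewrite in_itv /= x1 (le_trans x2 (ltW cth)).
have [c' ] := has_deriv_on_MVT tc sub dds.
rewrite in_itv /= => /andP[tc' c'c] e.
have -> : (s c - (s t + 0 * 2 * (c - t))) * (t + h - t) = ds c' * (c - t) * h.
  by rewrite -e; ring.
rewrite !normrM [`|h|]gtr0_norm// expr2 mulrA ler_wpM2r ?(ltW h0)//.
apply: ler_pM => //; last by rewrite gtr0_norm ?subr_gt0//; lra.
by apply: dsm; rewrite in_itv /= (ltW tc') ltW// (lt_trans c'c).
Qed.

(** Taylor expansion with Peano remainder: [l] minus its second-order polynomial has derivative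
    [s c - s t - q * (c - t)], which the expansion of [s] at [t] bounds by
    [e * (c - t) <= e * h]. *)
Lemma second_order_cvg (R : realType) (D : set R) (l s : R -> R) (t q : R) :
  D° t -> (forall x, D x -> has_deriv_on D l x (s x)) ->
  has_deriv_on D s t q ->
  forall e, 0 < e -> exists2 r, 0 < r & forall h, 0 < h -> h < r ->
    `|l (t + h) - l t - s t * h - q / 2 * h ^+ 2| <= e * h ^+ 2.
Proof.
move=> /nbhs_ballP[r0 /= r00 rD] dl /has_deriv_onP ds e e0.
have [r1 r10 r1P] := ds e e0.
exists (Num.min r0 r1); first by rewrite lt_min r00.
move=> h h0; rewrite lt_min => /andP[hr0 hr1].
have hD : `[t, t + h] `<=` D.
  move=> x; rewrite /= in_itv /= => /andP[tx xh]; apply: rD.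
  rewrite -ball_normE /= distrC ger0_norm ?subr_ge0//; lra.
pose k x := l x - (s t * (x - t) + q / 2 * (x - t) ^+ 2).
have dk x : D x -> has_deriv_on D k x (s x - (s t + q / 2 * 2 * (x - t))).
  by move=> Dx; exact: has_deriv_onB (dl _ Dx) (@has_deriv_on_quadratic _ D _ _ t x).
have th : t < t + h by rewrite ltrDl.
have [c] := has_deriv_on_MVT th hD dk.
move=> ch; have Dc := hD _ (subset_itv_oo_cc ch).
move: ch; rewrite in_itv /= => /andP[tc cth].
have -> : k (t + h) - k t = l (t + h) - l t - s t * h - q / 2 * h ^+ 2.
  by rewrite /k; ring.
move=> ->.
have -> : (s c - (s t + q / 2 * 2 * (c - t))) * (t + h - t) =
  (s c - s t - q * (c - t)) * h by field.
rewrite normrM [`|h|]gtr0_norm// expr2 mulrA ler_wpM2r ?(ltW h0)//.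
have c0 : `|c - t| = c - t by rewrite gtr0_norm// subr_gt0.
apply: le_trans (r1P c Dc _) _; first by rewrite c0; lra.
by rewrite c0 ler_wpM2l ?(ltW e0)//; lra.
Qed.

(** * Limits of sequences, uniform convergence and continuous functions on an interval *)

Lemma cvg_dist_bound (R : realType) (u v : nat -> R) (l : R) :
  (\forall n \near \oo, `|u n - l| <= v n) -> v n @[n --> \oo] --> 0 ->
  u n @[n --> \oo] --> l.
Proof.
move=> uv v0; apply/cvgrPdist_le => e e0.
move/cvgrPdist_le : v0 => /(_ e e0) ve; near=> n.
rewrite distrC; have le1 : `|u n - l| <= v n by near: n.
apply: le_trans le1 _; apply: le_trans (ler_norm _) _.
by rewrite -normrN -sub0r; near: n.
Unshelve. all: by end_near. Qed.

(** Split [f_ n (u n) - f l] at [f (u n)]: uniform convergence handles one half, continuity at [l]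
    the other. It serves to evaluate empirical functions at moving, sample-dependent points. *)
Lemma uniform_cvg_comp (R : realType) (D : set R) (f_ : nat -> R -> R)
    (f : R -> R) (u : nat -> R) (l : R) :
  (forall e, 0 < e -> \forall n \near \oo, forall t, D t -> `|f_ n t - f t| <= e) ->
  {for l, continuous f} -> (\forall n \near \oo, D (u n)) ->
  u n @[n --> \oo] --> l -> f_ n (u n) @[n --> \oo] --> f l.
Proof.
move=> unif cf Du ul.
have fu : f (u n) @[n --> \oo] --> f l by apply: continuous_cvg.
apply/cvgrPdist_le => e e0; have e20 : 0 < e / 2 by rewrite divr_gt0.
move/cvgrPdist_le : fu => /(_ _ e20) fu; have := unif _ e20 => un; near=> n.
have h1 : `|f l - f (u n)| <= e / 2 by near: n.
have h2 : `|f_ n (u n) - f (u n)| <= e / 2.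
  have Dn : D (u n) by near: n.
  (* Generalizing [u n] turns the goal into the uniform bound, valid for all large [n]. *)
  by move: {h1} (u n) Dn; near: n.
rewrite -(subrK (f (u n)) (f l)) -addrA (splitr e).
by rewrite (le_trans (ler_normD _ _))// lerD// distrC.
Unshelve. all: by end_near. Qed.

Lemma cvg_invsqrt_nat (R : realType) :
  (Num.sqrt (n%:R : R))^-1 @[n --> \oo] --> (0 : R).
Proof.
apply/cvgrPdist_le => e e0; near=> n.
have n0 : (0 < n)%N by near: n; exact: nbhs_infty_gt.
rewrite sub0r normrN ger0_norm ?invr_ge0 ?sqrtr_ge0//.
rewrite -[leRHS]invrK lef_pV2 ?posrE ?invr_gt0// ?sqrtr_gt0 ?ltr0n//.
rewrite -[leLHS]ger0_norm ?invr_ge0 ?(ltW e0)// -sqrtr_sqr ler_wsqrtr//.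
by near: n; exact: nbhs_infty_ger.
Unshelve. all: by end_near. Qed.

Lemma convex_set_is_interval (R : realType) (D : set R) :
  convex_set (D : set R^o) -> is_interval D.
Proof.
move=> cD x y Dx Dy t /andP[xt ty].
have [e|xy] := eqVneq x y.
  by have -> : t = x by apply/eqP; rewrite eq_le xt e ty.
have lt_xy : x < y by rewrite lt_neqAle xy (le_trans xt ty).
have d0 : 0 < y - x by rewrite subr_gt0.
(* The point [t] is the convex combination of [x] and [y] with weight [(y - t) / (y - x)] on [x]. *)
have l0 : 0 <= (y - t) / (y - x) by rewrite divr_ge0 ?(ltW d0)// subr_ge0.
have l1 : (y - t) / (y - x) <= 1 by rewrite ler_pdivrMr// mul1r lerD2l lerN2.
have : D ((y - t) / (y - x) * x + (1 - (y - t) / (y - x)) * y).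
  exact: set_mem (cD x y (Itv01 l0 l1) (mem_set Dx) (mem_set Dy)).
by have -> : (y - t) / (y - x) * x + (1 - (y - t) / (y - x)) * y = t
  by field; rewrite gt_eqF.
Qed.

(** The supremum is an extended real and may be infinite for some [n]; convergence to 0 makes it
    finite eventually, and it then bounds every [F n t]. *)
Lemma ereal_sup_cvg0_uniform (R : realType) (D : set R) (F : nat -> R -> R) :
  ereal_sup [set (F n t)%:E | t in D] @[n --> \oo] --> 0%E ->
  forall e, 0 < e -> \forall n \near \oo, forall t, D t -> F n t <= e.
Proof.
move=> /fine_cvgP[fin /cvgrPdist_le lim0] e e0; have {}lim0 := lim0 e e0.
near=> n => t Dt.
have fn : ereal_sup [set (F n t)%:E | t in D] \is a fin_num by near: n.
rewrite -lee_fin; apply: (@le_trans _ _ (ereal_sup [set (F n t)%:E | t in D])).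
  by apply: ereal_sup_ubound; exists t.
rewrite -(fineK fn) lee_fin; apply: le_trans (ler_norm _) _.
by rewrite -normrN -sub0r; near: n.
Unshelve. all: by end_near. Qed.

Lemma continuous_interior (R : realType) (D : set R) (f : R -> R) (x : R) :
  {within D, continuous f} -> D° x -> {for x, continuous f}.
Proof.
move=> /subspace_continuousP cf Dx.
by have := cf x (interior_subset Dx); rewrite within_interior.
Qed.

(** A sign change would produce a zero by the intermediate value theorem, so [f] keeps its sign at
    [x0]; compactness then gives a positive minimum and a maximum. *)
Lemma nonvanishing_continuous_bounds (R : realType) (D : set R) (f : R -> R)
    (x0 : R) :
  compact D -> is_interval D -> {within D, continuous f} ->
  (forall x, D x -> f x != 0) -> D x0 -> 0 < f x0 ->
  exists c M, 0 < c /\ forall x, D x -> c <= f x <= M.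
Proof.
move=> cD iD cf f0 Dx0 fx0.
have pos x : D x -> 0 < f x.
  move=> Dx; rewrite lt_neqAle eq_sym f0//= leNgt; apply/negP => fx.
  have ivt a b : a <= b -> D a -> D b ->
      Num.min (f a) (f b) <= 0 <= Num.max (f a) (f b) -> False.
    move=> ab Da Db mm.
    have sub : `[a, b] `<=` D.
      by move=> z; rewrite /= in_itv /= => zab; exact: iD zab.
    have [c cab fc0] := IVT ab (continuous_subspaceW sub cf) mm.
    by have := f0 c (sub _ cab); rewrite fc0 eqxx.
  have [h|h] := leP x x0.
    by apply: (ivt _ _ h) => //; rewrite ge_min le_max (ltW fx) (ltW fx0) orbT.
  by apply: (ivt _ _ (ltW h)) => //; rewrite ge_min le_max (ltW fx) (ltW fx0) orbT.
have D0 : D !=set0 by exists x0.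
have [c /[!inE] Dc cP] := compact_EVT_min D0 cD cf.
have [m _ mP] := compact_EVT_max D0 cD cf.
exists (f c), (f m); split; first exact: pos.
by move=> x Dx; rewrite cP ?inE// mP// inE.
Qed.

(** * Asymptotic equivalence along a fixed sample *)

Section PivotSandwich.
Context (R : realType) (D Theta : set R) (thetas z : R).
(** Along one sample, [L] is the mean log-likelihood, [S] the mean score, [A] is A_n and [b] is the
    square root of B_n; [Ainv] and [b0] are the population limits of [1 / A] and [b]. The constant
    [M] bounds both limits. *)
Context (L S A b : nat -> R -> R) (Ainv b0 : R -> R) (c M : R).
Context (th1 th2 hat : nat -> R).
Hypothesis iD : is_interval D.
Hypothesis sD : Theta `<=` D.
Hypothesis thetas_int : Theta° thetas.
Hypothesis dL : forall n x, D x -> has_deriv_on D (L n) x (S n x).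
Hypothesis dS : forall n x, D x -> has_deriv_on D (S n) x (- A n x).
Hypothesis cAinv : {for thetas, continuous Ainv}.
Hypothesis cb0 : {for thetas, continuous b0}.
Hypothesis c_gt0 : 0 < c.
Hypothesis Ainv_bnd : forall x, D x -> c <= Ainv x <= M.
Hypothesis b0_bnd : forall x, D x -> `|b0 x| <= M.
Hypothesis A_unif : forall e, 0 < e -> \forall n \near \oo,
  forall t, D t -> `|(A n t)^-1 - Ainv t| <= e.
Hypothesis b_unif : forall e, 0 < e -> \forall n \near \oo,
  forall t, D t -> `|b n t - b0 t| <= e.
Hypothesis S0 : S n thetas @[n --> \oo] --> 0.
Hypothesis hat_max : forall n, Theta (hat n) /\
  forall t, Theta t -> L n t <= L n (hat n).
Hypothesis pivot : \forall n \near \oo, [/\ Theta (th1 n), b n (th1 n) != 0 &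
  Num.sqrt n%:R * (b n (th1 n))^-1 * S n (th1 n) = z].
Hypothesis sandwich : \forall n \near \oo, b n (hat n) != 0 /\
  Num.sqrt n%:R * (b n (hat n))^-1 * A n (hat n) * (hat n - th2 n) = z.

Let M_gt0 : 0 < M.
Proof.
have /andP[cA AM] := Ainv_bnd (sD (interior_subset thetas_int)).
exact: lt_le_trans c_gt0 (le_trans cA AM).
Qed.

Lemma pivot_An_bounds : \forall n \near \oo,
  forall t, D t -> 0 < A n t /\ (M + 1)^-1 <= A n t <= (c / 2)^-1.
Proof.
(* An error of at most [c / 2] keeps [1 / A n] above [c / 2]; an error of at most 1 keeps it below
   [M + 1]. *)
have c20 : 0 < Num.min (c / 2) 1 by rewrite lt_min ltr01 divr_gt0.
have := A_unif c20; apply: filterS => n H t Dt.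
have := H t Dt; rewrite le_min => /andP[].
rewrite !ler_norml => /andP[h1 _] /andP[_ h2].
have /andP[cA AM] := Ainv_bnd Dt.
have l1 : c / 2 <= (A n t)^-1 by lra.
have l2 : (A n t)^-1 <= M + 1 by lra.
have c2 : 0 < c / 2 by rewrite divr_gt0.
have Ap : 0 < A n t by rewrite -invr_gt0; exact: lt_le_trans l1.
split => //; apply/andP; split.
  by rewrite -[leRHS]invrK lef_pV2 ?posrE ?invr_gt0// addr_gt0.
by rewrite -[leLHS]invrK lef_pV2 ?posrE ?invr_gt0.
Qed.

(** The pivot equation reads [S n (th1 n) = z * b n (th1 n) / sqrt n], which tends to 0, as does
    [S n thetas]. The slope of [S n] is at least [(M + 1)^-1] in absolute value, so the arguments
    must be close. *)
Lemma pivot_th1_cvg : th1 n @[n --> \oo] --> thetas.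
Proof.
(* The outer [M + 1] inverts the lower bound on the slope; the inner one bounds [b n (th1 n)]. *)
pose v n := (M + 1) * (`|z| * (M + 1) * (Num.sqrt n%:R)^-1 + `|S n thetas|).
apply: (@cvg_dist_bound _ _ v); last first.
  rewrite -(mulr0 (M + 1)); apply: cvgMr.
  rewrite -[X in _ --> X]addr0; apply: cvgD.
    by rewrite -(mulr0 (`|z| * (M + 1))); apply: cvgMr; exact: cvg_invsqrt_nat.
  by rewrite -(normr0 R); exact: cvg_norm.
have Dt := sD (interior_subset thetas_int).
near=> n.
have [Th1 bn0 eqz] : [/\ Theta (th1 n), b n (th1 n) != 0 &
  Num.sqrt n%:R * (b n (th1 n))^-1 * S n (th1 n) = z] by near: n.
have HA : forall t, D t -> 0 < A n t /\ (M + 1)^-1 <= A n t <= (c / 2)^-1.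
  by near: n; exact: pivot_An_bounds.
have Hb : forall t, D t -> `|b n t - b0 t| <= 1 by near: n; exact: b_unif.
have n0 : (0 < n)%N by near: n; exact: nbhs_infty_gt.
have [x [Dx _ eS]] := has_deriv_on_MVT_dist iD Dt (sD Th1) (@dS n).
have [Ap /andP[Al _]] := HA x Dx.
have sn : Num.sqrt (n%:R : R) != 0 by rewrite gt_eqF// sqrtr_gt0 ltr0n.
have bM : `|b n (th1 n)| <= M + 1.
  rewrite -(subrK (b0 (th1 n)) (b n _)) (le_trans (ler_normD _ _))// addrC lerD//.
    exact/b0_bnd/sD.
  exact/Hb/sD.
have SE : S n (th1 n) = z * b n (th1 n) * (Num.sqrt n%:R)^-1.
  by rewrite -eqz; field; rewrite sn bn0.
have SM : `|S n (th1 n)| <= `|z| * (M + 1) * (Num.sqrt n%:R)^-1.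
  rewrite SE !normrM [`|_^-1|]ger0_norm ?invr_ge0 ?sqrtr_ge0//.
  by rewrite ler_wpM2r ?invr_ge0 ?sqrtr_ge0// ler_wpM2l.
rewrite /v -ler_pdivrMl ?addr_gt0//.
apply: (@le_trans _ _ (A n x * `|th1 n - thetas|)); first exact: ler_wpM2r.
rewrite -[A n x]gtr0_norm// -normrM -[`|A n x * _|]normrN -mulNr -eS.
by rewrite (le_trans (ler_normB _ _))// lerD2r.
Unshelve. all: by end_near. Qed.

(** If [hat n] were beyond [thetas + e], maximality against [thetas + e] would give a point [x]
    between them with [S n x >= 0]. But [S n] falls from [thetas] to [x] by at least
    [(M + 1)^-1 * e], more than [S n thetas]. The left side is symmetric. Intermediate points are
    only known to lie in the interval [D]. *)
Lemma pivot_hat_near e : 0 < e ->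
  Theta (thetas - e) -> Theta (thetas + e) ->
  \forall n \near \oo, `|hat n - thetas| <= e.
Proof.
move=> e0 Tm Tp.
have Dt := sD (interior_subset thetas_int).
have sub x y : D x -> D y -> `[x, y] `<=` D.
  by move=> Dx Dy t; rewrite /= in_itv /= => xyt; exact: iD xyt.
have eM : 0 < (M + 1)^-1 * e by rewrite mulr_gt0// invr_gt0 addr_gt0.
have M1 : 0 < (M + 1)^-1 by rewrite invr_gt0 addr_gt0.
near=> n.
have HA : forall t, D t -> 0 < A n t /\ (M + 1)^-1 <= A n t <= (c / 2)^-1.
  by near: n; exact: pivot_An_bounds.
have Ssm : `|S n thetas| < (M + 1)^-1 * e.
  by rewrite -normrN -sub0r; near: n; move/cvgrPdist_lt : S0; exact.
have [Th hmax] := hat_max n.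
rewrite leNgt; apply/negP; rewrite ltr_normr opprB => /orP[] far.
  have lt1 : thetas + e < hat n by lra.
  have [x xh eL] := has_deriv_on_MVT lt1 (sub _ _ (sD Tp) (sD Th)) (@dL n).
  have Dx : D x by apply: sub (sD Tp) (sD Th) _ _; exact: subset_itv_oo_cc xh.
  move: xh; rewrite in_itv /= => /andP[x1 x2].
  have lt2 : thetas < x by lra.
  have [y yh eS] := has_deriv_on_MVT lt2 (sub _ _ Dt Dx) (@dS n).
  have Dy : D y by apply: sub Dt Dx _ _; exact: subset_itv_oo_cc yh.
  have [Ap /andP[Al _]] := HA y Dy.
  have Sx : 0 <= S n x.
    rewrite -(pmulr_lge0 _ (_ : 0 < hat n - (thetas + e))) ?subr_gt0// -eL.
    by rewrite subr_ge0 hmax.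
  have : (M + 1)^-1 * e <= A n y * (x - thetas).
    by apply: ler_pM; rewrite ?(ltW M1) ?(ltW e0)//; lra.
  move: Ssm; rewrite ltr_norml => /andP[_]; move: eS Sx; lra.
have lt1 : hat n < thetas - e by lra.
have [x xh eL] := has_deriv_on_MVT lt1 (sub _ _ (sD Th) (sD Tm)) (@dL n).
have Dx : D x by apply: sub (sD Th) (sD Tm) _ _; exact: subset_itv_oo_cc xh.
move: xh; rewrite in_itv /= => /andP[x1 x2].
have lt2 : x < thetas by lra.
have [y yh eS] := has_deriv_on_MVT lt2 (sub _ _ Dx Dt) (@dS n).
have Dy : D y by apply: sub Dx Dt _ _; exact: subset_itv_oo_cc yh.
have [Ap /andP[Al _]] := HA y Dy.
have Sx : S n x <= 0.
  rewrite -(pmulr_lle0 _ (_ : 0 < thetas - e - hat n)) ?subr_gt0// -eL.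
  by rewrite subr_le0 hmax.
have : (M + 1)^-1 * e <= A n y * (thetas - x).
  by apply: ler_pM; rewrite ?(ltW M1) ?(ltW e0)//; lra.
move: Ssm; rewrite ltr_norml => /andP[]; move: eS Sx; lra.
Unshelve. all: by end_near. Qed.

Lemma pivot_hat_cvg : hat n @[n --> \oo] --> thetas.
Proof.
have /nbhs_ballP[r /= r0 rT] := thetas_int.
apply/cvgrPdist_le => e e0.
(* The half radius keeps [thetas - d] and [thetas + d] inside [Theta]. *)
pose d := Num.min e (r / 2).
have d0 : 0 < d by rewrite lt_min e0 divr_gt0.
have dr : d < r by rewrite gt_min; apply/orP; right; lra.
have dn : \forall n \near \oo, `|hat n - thetas| <= d.
  apply: pivot_hat_near => //; apply: rT; rewrite -ball_normE /=.
    by rewrite subKr gtr0_norm.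
  by rewrite opprD addNKr normrN gtr0_norm.
apply: filterS dn => n; rewrite distrC => /le_trans; apply.
by rewrite ge_min lexx.
Qed.

(** By consistency [hat n] eventually lies in an open interval contained in [Theta]. The derivative
    of [L n] there is 0 at the maximum and also [S n (hat n)]. *)
Lemma pivot_S_hat0 : \forall n \near \oo, S n (hat n) = 0.
Proof.
have /nbhs_ballP[r /= r0 rT] := thetas_int.
have /cvgrPdist_lt/(_ _ r0) := pivot_hat_cvg; apply: filterS => n hr.
have [Th hmax] := hat_max n.
have rD : `]thetas - r, thetas + r[ `<=` Theta.
  move=> t; rewrite /= in_itv /= => ht; apply: rT.
  by rewrite -ball_normE /= distrC ltr_distl.
have ihat : hat n \in `]thetas - r, thetas + r[.
  by rewrite in_itv /= -ltr_distl distrC.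
have dL' t : t \in `]thetas - r, thetas + r[ -> is_derive t 1 (L n) (S n t).
  move=> ht; apply: (@has_deriv_on_is_derive _ D); last first.
    by apply: dL; apply/sD/rD.
  have : nbhs t `]thetas - r, thetas + r[%classic.
    by apply: open_nbhs_nbhs; split => //; exact: itv_open.
  by apply: filterS => u hu; apply/sD/rD.
have h0 : is_derive (hat n) 1 (L n) 0.
  apply: (derive1_at_max _ _ ihat); first by lra.
    by move=> t /dL' [].
  by move=> t ht; apply/hmax/rD.
have hS := dL' _ ihat.
by rewrite -(@derive_val _ _ _ _ _ _ _ hS) (@derive_val _ _ _ _ _ _ _ h0).
Qed.

Theorem pivot_sandwich_cvg :
  Num.sqrt n%:R * `|th1 n - th2 n| @[n --> \oo] --> 0.
Proof.
have Dhat n : D (hat n) by apply: sD; case: (hat_max n).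
(* [x n] is the mean value point between [th1 n] and [hat n]. Since [th1 n] is known to lie in [D]
   only for large [n], the value 0 is a default for the others. *)
have /choice[x xP] n : exists x, D (th1 n) ->
    [/\ D x, `|x - hat n| <= `|th1 n - hat n| &
      S n (th1 n) - S n (hat n) = - A n x * (th1 n - hat n)].
  have [Dn|] := pselect (D (th1 n)); last by exists 0.
  by have [x hx] := has_deriv_on_MVT_dist iD (Dhat n) Dn (@dS n); exists x.
have Dth1 : \forall n \near \oo, D (th1 n).
  by move: pivot; apply: filterS => n [/sD].
have Dx : \forall n \near \oo, D (x n).
  by move: Dth1; apply: filterS => n /(xP n)[].
have hatc := pivot_hat_cvg; have th1c := pivot_th1_cvg.
have xc : x n @[n --> \oo] --> thetas.
  apply: (@cvg_dist_bound _ _ (fun n => `|th1 n - hat n| + `|hat n - thetas|)).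
    move: Dth1; apply: filterS => n /(xP n)[_ h _].
    by rewrite -(subrK (hat n) (x n)) -addrA (le_trans (ler_normD _ _))// lerD2r.
  rewrite -[X in _ --> X]addr0; apply: cvgD.
    rewrite -(normr0 R); apply: cvg_norm; rewrite -(subrr thetas); exact: cvgB.
  rewrite -(normr0 R); apply: cvg_norm; rewrite -(subrr thetas).
  by apply: cvgB => //; exact: cvg_cst.
(* Solving the sandwich equation for [hat n - th2 n] and the pivot equation for [hat n - th1 n]
   shows that [w n] equals [sqrt n * (th1 n - th2 n)] for large [n]. *)
pose w n := z * (b n (hat n) * (A n (hat n))^-1 - b n (th1 n) * (A n (x n))^-1).
have wc : w n @[n --> \oo] --> 0.
  rewrite -(mulr0 z); apply: cvgMr.
  rewrite -(subrr (b0 thetas * Ainv thetas)).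
  apply: cvgB; apply: cvgM.
  - by apply: (uniform_cvg_comp b_unif) => //; exact: nearW.
  - by apply: (@uniform_cvg_comp _ D (fun n t => (A n t)^-1)) => //; exact: nearW.
  - exact: (uniform_cvg_comp b_unif).
  - exact: (@uniform_cvg_comp _ D (fun n t => (A n t)^-1)).
apply: (@cvg_dist_bound _ _ (fun n => `|w n|)); last first.
  by rewrite -(normr0 R); exact: cvg_norm.
have An := pivot_An_bounds; have S0n := pivot_S_hat0.
near=> n.
have [Th1 bn0 eqz] : [/\ Theta (th1 n), b n (th1 n) != 0 &
  Num.sqrt n%:R * (b n (th1 n))^-1 * S n (th1 n) = z] by near: n.
have [bh0 eqz'] : b n (hat n) != 0 /\
  Num.sqrt n%:R * (b n (hat n))^-1 * A n (hat n) * (hat n - th2 n) = z by near: n.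
have Sn0 : S n (hat n) = 0 by near: n.
have HA : forall t, D t -> 0 < A n t /\ (M + 1)^-1 <= A n t <= (c / 2)^-1.
  by near: n.
have [Dxn _ eS] := xP n (sD Th1).
have Ax0 : A n (x n) != 0 by rewrite gt_eqF//; case: (HA _ Dxn).
have Ah0 : A n (hat n) != 0 by rewrite gt_eqF//; case: (HA _ (Dhat n)).
rewrite subr0 normrM normr_id -normrM /w.
rewrite Sn0 subr0 in eS.
have e1 : z * (b n (hat n) * (A n (hat n))^-1) = Num.sqrt n%:R * (hat n - th2 n).
  by rewrite -eqz'; field; rewrite Ah0 bh0.
have e2 : z * (b n (th1 n) * (A n (x n))^-1) = Num.sqrt n%:R * (hat n - th1 n).
  by rewrite -eqz eS; field; rewrite Ax0 bn0.
rewrite [z * (_ - _)]mulrBr e1 e2 -mulrBr.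
by rewrite (_ : hat n - th2 n - (hat n - th1 n) = th1 n - th2 n)//; ring.
Unshelve. all: by end_near. Qed.

End PivotSandwich.

(** * A strong law for uncorrelated variables *)

Section RealIntegrable.
Context d (T : measurableType d) (R : realType).
Context (mu : {measure set T -> \bar R}) (D : set T).
Hypothesis mD : measurable D.
Implicit Types f h : T -> R.

Lemma integrableD_EFin f h :
  mu.-integrable D (EFin \o f) -> mu.-integrable D (EFin \o h) ->
  mu.-integrable D (EFin \o (fun x => f x + h x)).
Proof. by move=> fi hi; exact: (integrableD mD fi hi). Qed.

Lemma integrableB_EFin f h :
  mu.-integrable D (EFin \o f) -> mu.-integrable D (EFin \o h) ->
  mu.-integrable D (EFin \o (fun x => f x - h x)).
Proof. by move=> fi hi; exact: (integrableB mD fi hi). Qed.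

Lemma integrableZ_EFin c f :
  mu.-integrable D (EFin \o f) ->
  mu.-integrable D (EFin \o (fun x => c * f x)).
Proof. by move=> fi; exact: (integrableZl mD c fi). Qed.

Lemma le_integrable_EFin f h : measurable_fun D f ->
  (forall x, D x -> `|f x| <= h x) ->
  mu.-integrable D (EFin \o h) -> mu.-integrable D (EFin \o f).
Proof.
move=> mf fh; apply: le_integrable => //; first exact/measurable_EFinP.
by move=> x Dx /=; rewrite lee_fin (le_trans (fh x Dx))// ler_norm.
Qed.

(** Nonnegativity of [(f + h) ^+ 2] and [(f - h) ^+ 2] gives [|f * h| <= f ^+ 2 + h ^+ 2]. *)
Lemma integrable_mul_sq f h : measurable_fun D f -> measurable_fun D h ->
  mu.-integrable D (EFin \o (fun x => f x ^+ 2)) ->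
  mu.-integrable D (EFin \o (fun x => h x ^+ 2)) ->
  mu.-integrable D (EFin \o (fun x => f x * h x)).
Proof.
move=> mf mh f2 h2; apply: le_integrable_EFin (integrableD_EFin f2 h2).
  exact: measurable_funM.
move=> x _; rewrite ler_norml; apply/andP; split.
  have := sqr_ge0 (f x + h x); have := sqr_ge0 (f x); have := sqr_ge0 (h x); nra.
have := sqr_ge0 (f x - h x); have := sqr_ge0 (f x); have := sqr_ge0 (h x); nra.
Qed.

End RealIntegrable.

(** Independence identifies the joint law with the product of the marginals, as they agree on
    rectangles. By Fubini, integrating over [V] first gives [x * 0] for every value [x] of [U]. *)
Lemma independent_mean0_mul d (W : measurableType d) (R : realType)
    (P : probability W R) (U V : {RV P >-> R}) :
  (forall A B, measurable A -> measurable B ->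
    P (U @^-1` A `&` V @^-1` B) = (P (U @^-1` A) * P (V @^-1` B))%E) ->
  P.-integrable setT (EFin \o V) ->
  P.-integrable setT (EFin \o (fun w => U w * V w)) ->
  \int[P]_w V w = 0 -> \int[P]_w (U w * V w) = 0.
Proof.
move=> indep iV iUV V0.
pose UV w := (U w, V w).
have mUV : measurable_fun setT UV by exact: measurable_fun_pair.
pose UV' : {mfun W >-> _} := HB.pack UV (isMeasurableFun.Build _ _ _ _ _ mUV).
pose h (p : R * R) : \bar R := (p.1 * p.2)%:E.
have mh : measurable_fun setT h.
  by apply/measurable_EFinP/measurable_funM; [exact: measurable_fst|exact: measurable_snd].
have hE : (\int[distribution P UV']_p h p = \int[P]_w (U w * V w)%:E)%E.
  by rewrite integral_distribution.
have prodE A : measurable A ->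
    (distribution P U \x distribution P V)%E A = distribution P UV' A.
  by apply: product_measure_unique => B C mB mC; rewrite /= -indep.
(* Fubini asks for integrability under the product measure; it is carried over from [P] through the
   joint law. *)
have ih : (distribution P U \x distribution P V)%E.-integrable setT h.
  have := integrable_pushforward mUV mh iUV measurableT.
  move=> /integrableP[_ hoo]; apply/integrableP; split => //.
  rewrite (_ : integral _ _ _ = \int[distribution P UV']_x `|h x|)%E//.
  by apply: eq_measure_integral => A mA _; exact: prodE.
rewrite /Rintegral -hE.
have <- : (\int[(distribution P U \x distribution P V)%E]_p h p =
   \int[distribution P UV']_p h p)%E.
  by apply: eq_measure_integral => A mA _; exact: prodE.
rewrite -(integral12_prod_meas1 ih) /h /=.
have iV' : (distribution P V).-integrable setT (EFin \o id).
  exact: (integrable_pushforward (measurable_funP V) _ iV measurableT).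
have Vz : (\int[distribution P V]_y y%:E = 0)%E.
  rewrite (integral_distribution _ iV)//.
  by rewrite -(fineK (integrable_fin_num _ iV))// -/(Rintegral _ _ _) V0.
have H x : (\int[distribution P V]_y (x * y)%:E = 0)%E.
  have := @integralZl _ _ _ _ _ measurableT _ iV' x.
  by rewrite /comp Vz mule0.
have -> : (\int[distribution P U]_x \int[distribution P V]_y (x * y)%:E = 0)%E.
  by under eq_integral do rewrite H; rewrite integral0.
by [].
Qed.

Section StrongLaw.
Context d (W : measurableType d) (R : realType) (P : probability W R).

Section PartialSums.
Variables (X : nat -> W -> R) (v : R).
Hypothesis mX : forall i, measurable_fun setT (X i).
Hypothesis X2 : forall i, P.-integrable setT (EFin \o (fun w => X i w ^+ 2)).
Hypothesis X2v : forall i, \int[P]_w (X i w ^+ 2) <= v.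
Hypothesis uncor : forall i j, i != j -> \int[P]_w (X i w * X j w) = 0.

Let mS n : measurable_fun setT (fun w => \sum_(i < n) X i w).
Proof. exact: measurable_sum. Qed.

(** All summands have index below [k], so each product with [X k] has mean 0. Integrability is
    proved along with it because additivity of the integral requires it. *)
Lemma partial_sum_mul_later n k : (n <= k)%N ->
  P.-integrable setT (EFin \o (fun w => (\sum_(i < n) X i w) * X k w)) /\
  \int[P]_w ((\sum_(i < n) X i w) * X k w) = 0.
Proof.
elim: n => [_|n IH nk].
  have -> : (fun w => (\sum_(i < 0) X i w) * X k w) = cst 0.
    by apply/funext => w; rewrite big_ord0 mul0r.
  by split; [exact: integrable0|rewrite /Rintegral integral0].
have [i1 e1] := IH (ltnW nk).
have i2 : P.-integrable setT (EFin \o (fun w => X n w * X k w)).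
  by apply: integrable_mul_sq.
have -> : (fun w => (\sum_(i < n.+1) X i w) * X k w) =
   (fun w => (\sum_(i < n) X i w) * X k w + X n w * X k w).
  by apply/funext => w; rewrite big_ord_recr mulrDl.
split; first exact: integrableD_EFin.
by rewrite RintegralD// e1 uncor ?addr0// ltn_eqF.
Qed.

(** On expanding the square the cross term vanishes, so each new variable adds at most [v]. *)
Lemma partial_sum_second_moment n :
  P.-integrable setT (EFin \o (fun w => (\sum_(i < n) X i w) ^+ 2)) /\
  \int[P]_w ((\sum_(i < n) X i w) ^+ 2) <= n%:R * v.
Proof.
elim: n => [|n [i1 e1]].
  have -> : (fun w => (\sum_(i < 0) X i w) ^+ 2) = cst 0.
    by apply/funext => w; rewrite big_ord0 expr0n.
  by split; [exact: integrable0|rewrite /Rintegral integral0 mul0r].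
have [i2 e2] := partial_sum_mul_later (leqnn n).
have i3 := integrableZ_EFin measurableT 2 i2.
have -> : (fun w => (\sum_(i < n.+1) X i w) ^+ 2) =
   (fun w => (\sum_(i < n) X i w) ^+ 2 +
      2 * ((\sum_(i < n) X i w) * X n w) + X n w ^+ 2).
  by apply/funext => w; rewrite big_ord_recr sqrrD -mulr_natl.
have i4 := integrableD_EFin measurableT i1 i3.
split; first exact: integrableD_EFin.
rewrite RintegralD// RintegralD// RintegralZl// e2 mulr0 addr0.
by rewrite -natr1 mulrDl mul1r lerD.
Qed.

End PartialSums.

Lemma sum_invsq_le (n : nat) :
  \sum_(i < n) (i.+1%:R ^+ 2)^-1 <= 2 - n%:R^-1 :> R.
Proof.
(* Telescoping compares the term [1 / (x + 1)^2] with [1 / x - 1 / (x + 1)], which needs [x > 0].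
   The convention that the inverse of 0 is 0 makes the bound at [n = 0] equal to 2, so the first
   step is checked by hand. *)
elim: n => [|[|n] IH]; first by rewrite big_ord0 invr0; lra.
  by rewrite big_ord_recr big_ord0 /= expr1n invr1; lra.
rewrite big_ord_recr /=; apply: le_trans (lerD IH (lexx _)) _.
rewrite -addrA lerD2l -subr_ge0.
have p1 : 0 < n.+1%:R :> R by rewrite ltr0n.
have e : n.+2%:R = n.+1%:R + 1 :> R by rewrite natr1.
move: p1; rewrite e; move: (n.+1%:R) => x p1.
have -> : - (x + 1)^-1 - (- x^-1 + ((x + 1) ^+ 2)^-1) = (x * (x + 1) ^+ 2)^-1.
  by field; rewrite !gt_eqF// addr_gt0.
by rewrite invr_ge0 mulr_ge0 ?sqr_ge0// ltW.
Qed.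

(** The integrals are summable, with sum at most [2 * c], so by monotone convergence the series of
    the [f j] has finite integral and is finite almost everywhere. Its terms then tend to 0. *)
Lemma ae_cvg0_summable_integral (f : nat -> W -> R) (c : R) :
  (forall j, measurable_fun setT (f j)) -> (forall j w, 0 <= f j w) ->
  (forall j, P.-integrable setT (EFin \o f j)) ->
  (forall j, \int[P]_w f j w <= c * (j.+1%:R ^+ 2)^-1) ->
  {ae P, forall w, f j w @[j --> \oo] --> (0 : R)}.
Proof.
move=> mf f0 fi fc.
pose F w := (\sum_(j <oo) (f j w)%:E)%E.
have c0 : 0 <= c.
  have := le_trans (@Rintegral_ge0 _ _ _ P setT _ (fun w _ => f0 0%N w)) (fc 0%N).
  by rewrite expr1n invr1 mulr1.
have F0 w : (0 <= F w)%E by apply: nneseries_ge0 => n _ _; rewrite lee_fin.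
have mF : measurable_fun setT F.
  apply: ge0_emeasurable_sum => [k w _ _|k _]; first by rewrite lee_fin.
  exact/measurable_EFinP.
have iF : P.-integrable setT F.
  apply/integrableP; split => //.
  under eq_integral do rewrite gee0_abs//.
  rewrite integral_nneseries//; last 2 first.
    by move=> n; exact/measurable_EFinP.
    by move=> n w _; rewrite lee_fin.
  apply: (@le_lt_trans _ _ (c * 2)%:E); last exact: ltry.
  apply: lime_le.
    by apply: is_cvg_nneseries => n _ _; apply: integral_ge0 => w _; rewrite lee_fin.
  apply: nearW => n; rewrite big_mkord.
  have -> : (\sum_(i < n) \int[P]_w (f i w)%:E = (\sum_(i < n) \int[P]_w f i w)%:E)%E.
    rewrite -sumEFin; apply: eq_bigr => i _.
    rewrite /Rintegral fineK; first by [].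
    exact: integrable_fin_num (fi i).
  rewrite lee_fin; apply: (@le_trans _ _ (c * \sum_(i < n) (i.+1%:R ^+ 2)^-1)).
    by rewrite mulr_sumr; apply: ler_sum => i _.
  rewrite ler_wpM2l//; apply: le_trans (sum_invsq_le n) _.
  by rewrite gerBl invr_ge0.
have := integrable_ae measurableT iF; apply: filterS => w /(_ I) Ffin.
have Foo : (\sum_(0 <= k <oo) (f k w)%:E < +oo)%E by rewrite ltey_eq Ffin.
(* Each term is at most the tail that starts with it, and the tails of a finite series vanish. *)
have := nneseries_tail_cvg Foo (fun k _ => f0 k w).
move=> /fine_cvgP[fin /cvgrPdist_le tail].
apply/cvgrPdist_le => e e0; move: (tail e e0) => {}tail; near=> n.
have ft : (\sum_(n <= k <oo) (f k w)%:E)%E \is a fin_num by near: n.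
rewrite sub0r normrN ger0_norm//.
apply: (@le_trans _ _ (fine (\sum_(n <= k <oo) (f k w)%:E)%E)).
  rewrite -lee_fin fineK//.
  have := @nneseries_lim_ge R (fun k => (f k w)%:E) xpredT n n.+1.
  by rewrite big_nat1; apply=> k _; rewrite lee_fin.
apply: le_trans (ler_norm _) _; rewrite -normrN -sub0r; near: n; exact: tail.
Unshelve. all: by end_near. Qed.

(** Here [j] is the integer square root of [n]; consecutive squares differ by [2 j + 1], so the
    offset [k] restarts at 0 after [2 j]. *)
Lemma nat_sqrt_decomp (n : nat) :
  exists j k, n = (j ^ 2 + k)%N /\ (k <= j.*2)%N.
Proof.
elim: n => [|n [j [k [-> kj]]]]; first by exists 0%N, 0%N.
have [kj'|kj'] := ltnP k j.*2; first by exists j, k.+1; rewrite addnS.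
exists j.+1, 0%N; split => //.
have -> : k = j.*2 by apply/eqP; rewrite eqn_leq kj kj'.
by rewrite -mul2n !expnS !expn0; lia.
Qed.

Variables (X : nat -> W -> R) (v : R).
Hypothesis mX : forall i, measurable_fun setT (X i).
Hypothesis X2 : forall i, P.-integrable setT (EFin \o (fun w => X i w ^+ 2)).
Hypothesis X2v : forall i, \int[P]_w (X i w ^+ 2) <= v.
Hypothesis uncor : forall i j, i != j -> \int[P]_w (X i w * X j w) = 0.

(* f controls the means along the squares (j+1)^2, and g the fluctuation from
   (j+1)^2 up to the next square; both have expectation O(1/(j+1)^2). *)
Let S n w := \sum_(i < n) X i w.
Let J2 j : R := (j.+1%:R ^+ 2)^-1.
Let f j w := (S (j.+1 ^ 2) w * J2 j) ^+ 2.
Let blk j k w := \sum_(i < k) X (j.+1 ^ 2 + i)%N w.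
Let g j w := \sum_(k < (j.+1).*2.+1) (blk j k w * J2 j) ^+ 2.

Let v0 : 0 <= v.
Proof.
apply: le_trans (X2v 0%N); apply: Rintegral_ge0 => w _; exact: sqr_ge0.
Qed.

Let J2_gt0 j : 0 < J2 j.
Proof. by rewrite invr_gt0 exprn_gt0// ltr0n. Qed.

Let SE j k w : S (j.+1 ^ 2 + k) w = S (j.+1 ^ 2) w + blk j k w.
Proof. by rewrite /S big_split_ord. Qed.

Let int_scaled (Y : W -> R) c j b :
  P.-integrable setT (EFin \o (fun w => Y w ^+ 2)) ->
  \int[P]_w (Y w ^+ 2) <= c -> c * J2 j ^+ 2 <= b ->
  P.-integrable setT (EFin \o (fun w => (Y w * J2 j) ^+ 2)) /\
  \int[P]_w ((Y w * J2 j) ^+ 2) <= b.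
Proof.
move=> Yi Yc cb.
have -> : (fun w => (Y w * J2 j) ^+ 2) = (fun w => J2 j ^+ 2 * Y w ^+ 2).
  by apply/funext => w; rewrite exprMn mulrC.
split; first exact: integrableZ_EFin.
rewrite RintegralZl//; apply: le_trans cb.
by rewrite mulrC ler_wpM2r// sqr_ge0.
Qed.

Let blk_moment j k :
  P.-integrable setT (EFin \o (fun w => blk j k w ^+ 2)) /\
  \int[P]_w (blk j k w ^+ 2) <= k%:R * v.
Proof.
apply: (@partial_sum_second_moment (fun i => X (j.+1 ^ 2 + i)%N)) => //.
by move=> i i' ii'; apply: uncor; rewrite eqn_add2l.
Qed.

Let f_cvg : {ae P, forall w, f j w @[j --> \oo] --> (0 : R)}.
Proof.
have H j : P.-integrable setT (EFin \o f j) /\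
    \int[P]_w f j w <= v * (j.+1%:R ^+ 2)^-1.
  have [i e] := @partial_sum_second_moment X v mX X2 X2v uncor (j.+1 ^ 2).
  apply: (int_scaled i e).
  have j0 : j.+1%:R != 0 :> R by rewrite pnatr_eq0.
  rewrite natrX /J2; move: (j.+1%:R) j0 => x x0.
  by rewrite le_eqVlt; apply/orP; left; apply/eqP; field.
apply: (@ae_cvg0_summable_integral f v) => [j|j w|j|j].
- apply: measurable_funX; apply: measurable_funM => //; exact: measurable_sum.
- exact: sqr_ge0.
- by case: (H j).
- by case: (H j).
Qed.

Let g_cvg : {ae P, forall w, g j w @[j --> \oo] --> (0 : R)}.
Proof.
have H j k : (k <= j.+1.*2)%N ->
    P.-integrable setT (EFin \o (fun w => (blk j k w * J2 j) ^+ 2)) /\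
    \int[P]_w ((blk j k w * J2 j) ^+ 2) <= 2 * j.+1%:R * v * J2 j ^+ 2.
  move=> kj; have [i e] := blk_moment j k; apply: (int_scaled i e).
  rewrite ler_wpM2r ?sqr_ge0// ler_wpM2r//.
  by rewrite -natrM ler_nat mul2n.
have HS j m : (m <= j.+1.*2.+1)%N ->
    P.-integrable setT (EFin \o (fun w => \sum_(k < m) (blk j k w * J2 j) ^+ 2)) /\
    \int[P]_w (\sum_(k < m) (blk j k w * J2 j) ^+ 2) <=
      m%:R * (2 * j.+1%:R * v * J2 j ^+ 2).
  elim: m => [_|m IH mj].
    have -> : (fun w => \sum_(k < 0) (blk j k w * J2 j) ^+ 2) = cst 0.
      by apply/funext => w; rewrite big_ord0.
    by split; [exact: integrable0|rewrite /Rintegral integral0 mul0r].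
  have [i1 e1] := IH (ltnW mj); have [i2 e2] := H j m mj.
  have -> : (fun w => \sum_(k < m.+1) (blk j k w * J2 j) ^+ 2) =
    (fun w => \sum_(k < m) (blk j k w * J2 j) ^+ 2 + (blk j m w * J2 j) ^+ 2).
    by apply/funext => w; rewrite big_ord_recr.
  split; first exact: integrableD_EFin.
  by rewrite RintegralD// -natr1 mulrDl mul1r lerD.
(* With [x = j + 1] there are [2 x + 1] offsets, each contributing at most [2 * x * v / x^4]; the
   constant 6 comes from [2 * (2 * x + 1) <= 6 * x] for [x >= 1]. *)
apply: (@ae_cvg0_summable_integral g (6 * v)) => [j|j w|j|j].
- apply: measurable_sum => k; apply: measurable_funX.
  by apply: measurable_funM => //; exact: measurable_sum.
- by apply: sumr_ge0 => k _; exact: sqr_ge0.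
- by case: (HS j _ (leqnn _)).
- case: (HS j _ (leqnn _)) => _ /le_trans; apply.
  have e : j.+1.*2.+1%:R = 2 * j.+1%:R + 1 :> R by rewrite -natr1 -muln2 natrM mulrC.
  have x1 : 1 <= j.+1%:R :> R by rewrite ler1n.
  rewrite e /J2; move: (j.+1%:R) x1 => x x1.
  have x0 : 0 < x by lra.
  have -> : (2 * x + 1) * (2 * x * v * (x ^+ 2)^-1 ^+ 2) =
    (2 * (2 * x + 1) / x) * (v * (x ^+ 2)^-1).
    by field; rewrite gt_eqF.
  rewrite -[6 * v * _]mulrA; apply: ler_wpM2r.
    by rewrite mulr_ge0// invr_ge0 sqr_ge0.
  by rewrite ler_pdivrMr//; lra.
Qed.

(** Write [n] as a square [(j + 1)^2] plus an offset. Dividing by the square instead of [n] only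
    enlarges the mean, which is then bounded by the value at the square plus the fluctuation after
    it. *)
Theorem uncorrelated_strong_law :
  {ae P, forall w, n%:R^-1 * \sum_(i < n) X i w @[n --> \oo] --> (0 : R)}.
Proof.
move: f_cvg g_cvg; apply: filterS2 => w /cvgrPdist_le fw /cvgrPdist_le gw.
apply/cvgrPdist_le => e e0.
have e20 : 0 < (e / 2) ^+ 2 by rewrite exprn_gt0// divr_gt0.
have [N1 _ HN1] := fw _ e20; have [N2 _ HN2] := gw _ e20.
pose N := (maxn N1 N2).+1.
exists (N.+1 ^ 2)%N => // n /= Nn.
(* Root 0 forces [n = 0], excluded by the threshold. Otherwise the root is [j.+1], matching the
   indexing of [f] and [g]. *)
have [[|j] [k [nE kj]]] := nat_sqrt_decomp n.
  by move: Nn; rewrite nE; move: kj; rewrite leqn0 => /eqP ->; rewrite leqn0 expn_eq0.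
have jN : (N <= j.+1)%N.
  rewrite leqNgt; apply/negP => jN.
  have : (n < N.+1 ^ 2)%N; last by rewrite ltnNge Nn.
  apply: (@leq_trans (j.+2 ^ 2)); last by rewrite leq_sqr; lia.
  by rewrite nE !expnS !expn0; lia.
have sq_le (x : R) : x ^+ 2 <= (e / 2) ^+ 2 -> `|x| <= e / 2.
  by rewrite -real_normK ?num_real// ler_pXn2r// nnegrE ltW// divr_gt0.
have fj : `|S (j.+1 ^ 2) w * J2 j| <= e / 2.
  apply: sq_le; have : (N1 <= j)%N by move: jN; rewrite /N; lia.
  by move=> /HN1; rewrite sub0r normrN ger0_norm// sqr_ge0.
have gj : `|blk j k w * J2 j| <= e / 2.
  apply: sq_le; have : (N2 <= j)%N by move: jN; rewrite /N; lia.
  move=> /HN2; rewrite sub0r normrN ger0_norm; last first.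
    by apply: sumr_ge0 => i _; exact: sqr_ge0.
  apply: le_trans; have kj' : (k < j.+1.*2.+1)%N by [].
  (* The square for the offset [k] is one of the nonnegative terms summed in [g j]. *)
  rewrite /g (bigD1 (Ordinal kj'))//= lerDl.
  by apply: sumr_ge0 => i _; exact: sqr_ge0.
rewrite sub0r normrN normrM ger0_norm ?invr_ge0// -/(S n w) mulrC.
apply: (@le_trans _ _ (`|S n w| * J2 j)).
  rewrite ler_wpM2l// /J2 -natrX lef_pV2 ?posrE ?ltr0n ?expn_gt0//.
    by rewrite nE ler_nat leq_addr.
  by rewrite nE addn_gt0 expn_gt0.
rewrite -[J2 j]gtr0_norm// -normrM nE SE mulrDl (splitr e).
by rewrite (le_trans (ler_normD _ _))// lerD.
Qed.

End StrongLaw.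

(** * Laws given by a density *)

Section LawWithDensity.
Context d (T : measurableType d) (R : realType).
Context (nu Q : {measure set T -> \bar R}) (S : set T) (g : T -> R).
Hypothesis mS : measurable S.
Hypothesis mg : measurable_fun S g.
Hypothesis g0 : forall x, S x -> 0 <= g x.
Hypothesis lawE : forall A : set T, measurable A -> A `<=` S ->
  Q A = (\int[nu]_(x in A) (g x)%:E)%E.

Import HBNNSimple.

(** The law is described only on subsets of [S], so it is applied to the intersection of [A] with
    [S]. *)
Let law_indic (A : set T) (k : R) : measurable A -> 0 <= k ->
  (\int[Q]_(x in S) (k * \1_A x)%:E =
   \int[nu]_(x in S) (k * \1_A x * g x)%:E)%E.
Proof.
move=> mA k0.
have mAg : measurable_fun S (EFin \o (fun x => \1_A x * g x)).
  by apply/measurable_EFinP/measurable_funM.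
have -> : (\int[Q]_(x in S) (k * \1_A x)%:E = k%:E * Q (A `&` S))%E.
  under eq_integral do rewrite EFinM.
  by rewrite ge0_integralZl ?integral_indic//; apply/measurable_EFinP/measurable_indic.
under eq_integral do rewrite -mulrA EFinM.
rewrite ge0_integralZl//; last first.
  by move=> x Sx; rewrite lee_fin mulr_ge0// g0.
congr (_ * _)%E; rewrite lawE//; last exact: measurableI.
rewrite setIC integral_mkcondr; apply: eq_integral => x xS.
rewrite patchE indicE; case: (x \in A); first by rewrite mul1r.
by rewrite mul0r.
Qed.

(** Indicators give simple functions by linearity, and increasing simple approximations give [h] by
    monotone convergence on both sides; [g >= 0] keeps the products increasing. *)
Lemma ge0_law_integral (h : T -> R) : measurable_fun S h ->
  (forall x, S x -> 0 <= h x) ->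
  (\int[Q]_(x in S) (h x)%:E = \int[nu]_(x in S) (h x * g x)%:E)%E.
Proof.
move=> mh h0.
have mh' : measurable_fun S (EFin \o h) by exact/measurable_EFinP.
pose f_ := nnsfun_approx mS mh'.
have f_h x : S x -> EFin \o f_ ^~ x @ \oo --> (h x)%:E.
  by move=> Sx; apply: (cvg_nnsfun_approx mS mh') => // z Sz; rewrite lee_fin h0.
have nd_f x : nondecreasing_seq (f_ ^~ x).
  by move=> m n mn; exact/lefP/nd_nnsfun_approx.
have mf n : measurable_fun S (f_ n) by exact: measurable_funTS.
transitivity (limn (fun n => \int[Q]_(x in S) (f_ n x)%:E)%E).
  rewrite -monotone_convergence//.
  - by apply: eq_integral => x /[!inE] Sx; apply/esym/cvg_lim => //; exact: f_h.
  - by move=> n; exact/measurable_EFinP.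
  - by move=> n x _; rewrite lee_fin.
  - by move=> x _ m n mn; rewrite lee_fin; exact: nd_f.
transitivity (limn (fun n => \int[nu]_(x in S) (f_ n x * g x)%:E)%E); last first.
  rewrite -monotone_convergence//.
  - apply: eq_integral => x /[!inE] Sx; apply/cvg_lim => //.
    under eq_fun do rewrite EFinM.
    by rewrite EFinM; apply: cvgeZr => //; exact: f_h.
  - by move=> n; apply/measurable_EFinP/measurable_funM.
  - by move=> n x Sx; rewrite lee_fin mulr_ge0// g0.
  - by move=> x Sx m n mn; rewrite lee_fin ler_wpM2r ?g0//; exact: nd_f.
congr (limn _); apply/funext => n.
have fE x : f_ n x = \sum_(k \in range (f_ n)) k * \1_(f_ n @^-1` [set k]) x.
  by rewrite [in LHS]fimfunE.
transitivity (\sum_(k \in range (f_ n))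
    \int[Q]_(x in S) (k * \1_(f_ n @^-1` [set k]) x)%:E)%E.
  rewrite -ge0_integral_fsum//.
  - by apply: eq_integral => x _; rewrite fE -fsumEFin.
  - by move=> k; apply/measurable_EFinP/measurable_funM => //; exact: measurable_indic.
  - by move=> k x _; rewrite nnfun_muleindic_ge0.
transitivity (\sum_(k \in range (f_ n))
    \int[nu]_(x in S) (k * \1_(f_ n @^-1` [set k]) x * g x)%:E)%E; last first.
  rewrite -ge0_integral_fsum//.
  - apply: eq_integral => x _; rewrite fE fsumEFin//; congr EFin.
    by rewrite -mulr_fsuml.
  - move=> k; apply/measurable_EFinP/measurable_funM => //.
    by apply/measurable_funM => //; exact: measurable_indic.
  - move=> k x Sx; rewrite lee_fin mulr_ge0 ?g0//.
    by rewrite -lee_fin EFinM nnfun_muleindic_ge0.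
apply: eq_fsbigr => k /[!inE] -[x _ <-].
by apply: law_indic.
Qed.

Lemma law_integrableP (h : T -> R) : measurable_fun S h ->
  Q.-integrable S (EFin \o h) <->
  nu.-integrable S (fun x => (h x * g x)%:E).
Proof.
move=> mh.
have e : (\int[Q]_(x in S) `|(h x)%:E| = \int[nu]_(x in S) `|(h x * g x)%:E|)%E.
  transitivity (\int[nu]_(x in S) (`|h x| * g x)%:E)%E.
    apply: ge0_law_integral => //; exact: measurableT_comp.
  by apply: eq_integral => x /[!inE] Sx /=; rewrite normrM (ger0_norm (g0 Sx)).
split=> /integrableP[_ hoo]; apply/integrableP; split.
- by apply/measurable_EFinP/measurable_funM.
- by rewrite -e.
- exact/measurable_EFinP.
- by rewrite [ltLHS]e.
Qed.

Lemma law_Rintegral (h : T -> R) : measurable_fun S h ->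
  Q.-integrable S (EFin \o h) ->
  \int[Q]_(x in S) h x = \int[nu]_(x in S) (h x * g x).
Proof.
move=> mh ih.
(* As [h = a - b] with both parts nonnegative and integrable, the nonnegative case applies to
   each. *)
pose a x := `|h x| + h x; pose b x := `|h x|.
have mb : measurable_fun S b by exact: measurableT_comp.
have ma : measurable_fun S a by exact: measurable_funD.
have ib : Q.-integrable S (EFin \o b) by exact: integrable_norm.
have ia : Q.-integrable S (EFin \o a) by exact: integrableD_EFin.
have a0 x : S x -> 0 <= a x by move=> _; rewrite /a -lerBlDr sub0r -normrN ler_norm.
have ea : \int[Q]_(x in S) a x = \int[nu]_(x in S) (a x * g x).
  by rewrite /Rintegral ge0_law_integral.
have eb : \int[Q]_(x in S) b x = \int[nu]_(x in S) (b x * g x).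
  by rewrite /Rintegral ge0_law_integral// => x _; exact: normr_ge0.
have -> : \int[Q]_(x in S) h x = \int[Q]_(x in S) (a x - b x).
  by apply: eq_Rintegral => x _; rewrite /a /b addrAC subrr add0r.
rewrite RintegralB// ea eb -RintegralB//.
- by apply: eq_Rintegral => x _; rewrite /a /b -mulrBl addrAC subrr add0r.
- exact/(law_integrableP ma).
- exact/(law_integrableP mb).
Qed.

End LawWithDensity.

(** * Interior maximum of an expected log-likelihood *)

Lemma dominated_convergence_Rintegral d (T : measurableType d) (R : realType)
    (Q : {measure set T -> \bar R}) (S : set T) (f_ : nat -> T -> R)
    (f m : T -> R) :
  measurable S -> (forall n, measurable_fun S (f_ n)) -> measurable_fun S f ->
  (forall x, S x -> f_ n x @[n --> \oo] --> f x) ->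
  Q.-integrable S (EFin \o m) ->
  (forall n x, S x -> `|f_ n x| <= m x) ->
  Q.-integrable S (EFin \o f) /\
  \int[Q]_(x in S) f_ n x @[n --> \oo] --> \int[Q]_(x in S) f x.
Proof.
move=> mS mf_ mf f_f im fm.
have [||||iF _ F_F] := @dominated_convergence _ _ _ Q S mS
    (fun n x => (f_ n x)%:E) (EFin \o f) (EFin \o m) _ _ _ im.
- by move=> n; exact/measurable_EFinP.
- exact/measurable_EFinP.
- by apply: aeW => x Sx; apply: cvg_EFin; [exact: nearW|exact: f_f].
- by apply: aeW => x n Sx; rewrite lee_fin fm.
split => //; apply: fine_cvg; rewrite fineK//.
exact: integrable_fin_num iF.
Qed.

Section PopulationMaximum.
Context d (T : measurableType d) (R : realType) (Q : probability T R).
Context (S : set T) (D Theta : set R) (thetas : R) (l s ds : T -> R -> R).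
Context (m1 m2 : T -> R).
Hypothesis mS : measurable S.
Hypothesis iD : is_interval D.
Hypothesis sD : Theta `<=` D.
Hypothesis thetas_int : Theta° thetas.
Hypothesis dl : forall u x, S u -> D x -> has_deriv_on D (l u) x (s u x).
Hypothesis dds : forall u x, S u -> D x -> has_deriv_on D (s u) x (ds u x).
Hypothesis il : forall t, Theta t -> Q.-integrable S (EFin \o l ^~ t).
Hypothesis ms : measurable_fun S (s ^~ thetas).
Hypothesis mds : measurable_fun S (ds ^~ thetas).
Hypothesis im1 : Q.-integrable S (EFin \o m1).
Hypothesis im2 : Q.-integrable S (EFin \o m2).
Hypothesis dsm1 : forall u t, S u -> Theta t -> `|ds u t| <= m1 u.
Hypothesis sm2 : forall u t, S u -> Theta t -> s u t ^+ 2 <= m2 u.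
Hypothesis max_l : forall t, Theta t ->
  \int[Q]_(u in S) l u t <= \int[Q]_(u in S) l u thetas.

Let Tth : Theta thetas. Proof. exact: interior_subset. Qed.

Let ml t : Theta t -> measurable_fun S (l ^~ t).
Proof. by move=> /il /measurable_int /measurable_EFinP. Qed.

(** By the mean value theorem each quotient is a score at a point of [Theta], and
    [|x| <= 1 + x ^+ 2] bounds it by [1 + m2]. Dominated convergence then exchanges derivative and
    integral. *)
Lemma mean_difference_quotient_cvg (r : R) (h : nat -> R) :
  ball thetas r `<=` Theta -> (forall n, h n != 0) -> (forall n, `|h n| < r) ->
  h n @[n --> \oo] --> 0 ->
  Q.-integrable S (EFin \o s ^~ thetas) /\
  (\int[Q]_(u in S) l u (thetas + h n) - \int[Q]_(u in S) l u thetas) / h n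
    @[n --> \oo] --> \int[Q]_(u in S) s u thetas.
Proof.
move=> rT h0 hr h_0.
have inT x : `|x - thetas| < r -> Theta x.
  by move=> xr; apply: rT; rewrite -ball_normE /= distrC.
have Th n : Theta (thetas + h n) by apply: inT; rewrite addrAC subrr add0r.
pose F n u := (h n)^-1 * (l u (thetas + h n) - l u thetas).
have mF n : measurable_fun S (F n).
  by apply: measurable_funM => //; apply: measurable_funB; exact: ml.
have [is_ cs] : Q.-integrable S (EFin \o s ^~ thetas) /\
    \int[Q]_(u in S) F n u @[n --> \oo] --> \int[Q]_(u in S) s u thetas.
  apply: (@dominated_convergence_Rintegral _ _ _ _ _ _ _ (fun u => 1 + m2 u)) => //.
  - move=> u Su; apply/cvgrPdist_le => e e0.
    have /has_deriv_onP/(_ e e0)[r1 r10 r1P] := dl Su (sD Tth).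
    move/cvgrPdist_lt : h_0 => /(_ r1 r10); apply: filterS => n.
    rewrite sub0r normrN => hn.
    have := r1P _ (sD (Th n)); rewrite addrAC subrr add0r => /(_ hn) q.
    rewrite -(ler_pM2r (_ : 0 < `|h n|)) ?normr_gt0// -normrM mulrBl distrC /F.
    by rewrite [_^-1 * _]mulrC divfK.
  - apply: integrableD_EFin => //; exact: finite_measure_integrable_cst.
  - move=> n u Su.
    have [c [Dc cn e]] := has_deriv_on_MVT_dist iD (sD Tth) (sD (Th n)) (fun x => @dl u x Su).
    rewrite /F e addrAC subrr add0r mulrCA mulVf// mulr1.
    have Tc : Theta c.
      by apply: inT; apply: le_lt_trans cn _; rewrite addrAC subrr add0r.
    have := sm2 Su Tc; move: (s u c) => x x2.
    rewrite ler_norml; apply/andP; split.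
      have := sqr_ge0 (x + 1); have := sqr_ge0 x; nra.
    have := sqr_ge0 (x - 1); have := sqr_ge0 x; nra.
split => //.
suff -> : (fun n => (\int[Q]_(u in S) l u (thetas + h n) -
    \int[Q]_(u in S) l u thetas) / h n) = (fun n => \int[Q]_(u in S) F n u) by [].
apply/funext => n; rewrite /F RintegralZl//.
  by rewrite RintegralB// 1?mulrC//; exact: il.
by apply: integrableB_EFin => //; exact: il.
Qed.

Let vanishing_step (r : R) : 0 < r -> exists h : nat -> R,
  [/\ forall n, 0 < h n, forall n, h n < r & h n @[n --> \oo] --> 0].
Proof.
(* The shift by 2 makes the steps strictly smaller than [r] already at [n = 0]. *)
move=> r0; exists (fun n => r * n.+2%:R^-1); split => [n|n|].
- by rewrite mulr_gt0// invr_gt0 ltr0n.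
- by rewrite gtr_pMr// invf_lt1// ltr1n.
- rewrite -(mulr0 r); apply: cvgMr.
  by have := @cvg_harmonic R; rewrite -(cvg_shiftn 1); under eq_fun do rewrite addn1.
Qed.

(** At the maximum the quotients of the mean log-likelihood are nonpositive along positive steps and
    nonnegative along negative ones; both have the mean score as limit. *)
Lemma mean_score_eq0 : Q.-integrable S (EFin \o s ^~ thetas) /\
  \int[Q]_(u in S) s u thetas = 0.
Proof.
have /nbhs_ballP[r /= r0 rT] := thetas_int.
have [h [h0 hr h_0]] := vanishing_step r0.
have [|||is_ c1] := @mean_difference_quotient_cvg r h rT => //.
- by move=> n; rewrite gt_eqF.
- by move=> n; rewrite gtr0_norm.
have [|||_ c2] := @mean_difference_quotient_cvg r (fun n => - h n) rT => //.
- by move=> n; rewrite oppr_eq0 gt_eqF.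
- by move=> n; rewrite normrN gtr0_norm.
- by rewrite -oppr0; exact: cvgN.
split => //; apply/eqP; rewrite eq_le; apply/andP; split.
  apply: cvgr_to_le c1 _; apply: nearW => n.
  rewrite pmulr_lle0 ?invr_gt0// subr_le0; apply/max_l/rT.
  by rewrite -ball_normE /= opprD addNKr normrN gtr0_norm.
apply: cvgr_to_ge c2 _; apply: nearW => n.
rewrite nmulr_lge0 ?invr_lt0 ?oppr_lt0// subr_le0; apply/max_l/rT.
by rewrite -ball_normE /= opprB addrCA subrr addr0 gtr0_norm.
Qed.

(** The increment of the mean log-likelihood divided by [h n ^+ 2] is nonpositive at the maximum,
    and its limit is half the mean of [ds]. *)
Lemma mean_score_deriv_le0 : \int[Q]_(u in S) ds u thetas <= 0.
Proof.
have /nbhs_ballP[r /= r0 rT] := thetas_int.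
have [h [h0 hr h_0]] := vanishing_step r0.
have [is_ s0] := mean_score_eq0.
have Th n : Theta (thetas + h n).
  by apply: rT; rewrite -ball_normE /= opprD addNKr normrN gtr0_norm.
(* The first-order term may be subtracted because its mean is 0; dominated
   convergence then applies with the bound m1 on the second derivative. *)
pose F n u := (h n ^+ 2)^-1 * (l u (thetas + h n) - l u thetas - h n * s u thetas).
have Dth : D° thetas by apply: filterS thetas_int.
have ids : Q.-integrable S (EFin \o ds ^~ thetas).
  by apply: le_integrable_EFin im1 => // u Su; exact: dsm1.
have mF n : measurable_fun S (F n).
  apply: measurable_funM => //; apply: measurable_funB.
    by apply: measurable_funB; exact: ml.
  exact: measurable_funM.
have [_] : Q.-integrable S (EFin \o (fun u => 2^-1 * ds u thetas)) /\
    \int[Q]_(u in S) F n u @[n --> \oo] --> \int[Q]_(u in S) (2^-1 * ds u thetas).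
  apply: (@dominated_convergence_Rintegral _ _ _ _ _ _ _ m1) => //.
  - exact: measurable_funM.
  - move=> u Su; apply/cvgrPdist_le => e e0.
    have [r1 r10 r1P] := second_order_cvg Dth (fun x => @dl u x Su) (dds Su (sD Tth)) e0.
    move/cvgrPdist_lt : h_0 => /(_ r1 r10); apply: filterS => n.
    rewrite sub0r normrN gtr0_norm// => hn.
    have q := r1P _ (h0 n) hn.
    have hh : 0 < h n ^+ 2 by rewrite exprn_gt0.
    rewrite -(ler_pM2r hh) -{1}[h n ^+ 2]gtr0_norm// -normrM mulrBl distrC /F.
    rewrite [(h n ^+ 2)^-1 * _]mulrC divfK ?gt_eqF//.
    by move: q; rewrite [h n * _]mulrC [2^-1 * _]mulrC.
  - move=> n u Su.
    have sub : `[thetas, thetas + h n] `<=` Theta.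
      move=> x; rewrite /= in_itv /= => /andP[x1 x2]; apply: rT.
      rewrite -ball_normE /= distrC ger0_norm ?subr_ge0//.
      by have := hr n; lra.
    have q := @second_order_bound _ D _ _ _ thetas (m1 u) _ (h0 n)
      (subset_trans sub sD) (fun x => @dl u x Su) (fun x => @dds u x Su)
      (fun x xh => @dsm1 u x Su (sub x xh)).
    have hh : 0 < h n ^+ 2 by rewrite exprn_gt0.
    rewrite /F [(h n ^+ 2)^-1 * _]mulrC normrM normfV (gtr0_norm hh).
    by rewrite ler_pdivrMr// [h n * _]mulrC.
rewrite RintegralZl// => cF.
rewrite -(pmulr_rle0 _ (_ : 0 < 2^-1)) ?invr_gt0//.
apply: cvgr_to_le cF _; apply: nearW => n.
rewrite /F RintegralZl//; last first.
  apply: integrableB_EFin => //; last exact: integrableZ_EFin.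
  by apply: integrableB_EFin => //; exact: il.
rewrite RintegralB//; last 2 first.
- by apply: integrableB_EFin => //; exact: il.
- exact: integrableZ_EFin.
rewrite RintegralZl// s0 mulr0 subr0 RintegralB//; try exact: il.
rewrite pmulr_rle0 ?invr_gt0 ?exprn_gt0// subr_le0; exact: max_l.
Qed.

End PopulationMaximum.

Lemma RV_Rintegral d d' (W : measurableType d) (T : measurableType d')
    (R : realType) (P : probability W R) (X : {RV P >-> T}) (f : T -> R) :
  measurable_fun setT f ->
  (distribution P X).-integrable setT (EFin \o f) ->
  P.-integrable setT (EFin \o (f \o X)) /\
  \int[P]_w f (X w) = \int[distribution P X]_u f u.
Proof.
move=> mf /integrableP[mf' foo].
have i : P.-integrable setT (EFin \o (f \o X)).
  apply/integrableP; split.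
    by apply/measurable_EFinP; exact: measurableT_comp.
  move: foo; rewrite ge0_integral_distribution//.
  by apply: measurableT_comp.
split => //; rewrite /Rintegral integral_distribution//.
Qed.

(** * The sampled model *)

Section SampleFromDensity.
Context (R : realType) (k : nat) (d : measure_display) (W : measurableType d).
Context (P : probability W R) (S : set (k.-tuple R)).
Context (nu : {measure set (k.-tuple R) -> \bar R}) (g : k.-tuple R -> R).
Context (y : nat -> {RV P >-> k.-tuple R}).
Hypothesis iid : iid_with_density S nu g y.

Let mS := sample_space_measurable iid.

Lemma law_integrable_under_g i (h : k.-tuple R -> R) :
  integrable_under_g S nu g h ->
  (distribution P (y i)).-integrable S (EFin \o h) /\
  \int[distribution P (y i)]_(u in S) h u = expect_g S nu g h.
Proof.
move=> [mh ih].
have iQ : (distribution P (y i)).-integrable S (EFin \o h).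
  exact/(law_integrableP mS (density_measurable iid) (density_ge0 iid)
    (sample_law iid i) mh).
split => //.
exact: (law_Rintegral mS (density_measurable iid) (density_ge0 iid)
  (sample_law iid i) mh iQ).
Qed.

(** Measurability of [h] is known on [S] only, so [h] is extended by 0; the observations always lie
    in [S]. *)
Lemma sample_Rintegral i (h : k.-tuple R -> R) : integrable_under_g S nu g h ->
  P.-integrable setT (EFin \o (fun w => (h \_ S) (y i w))) /\
  \int[P]_w (h \_ S) (y i w) = expect_g S nu g h.
Proof.
move=> ih; have [iQ <-] := law_integrable_under_g i ih.
have mh : measurable_fun setT (h \_ S) by have [mh _] := ih; exact/(measurable_restrictT h mS).
have iQT : (distribution P (y i)).-integrable setT (EFin \o (h \_ S)).
  move/(integrable_mkcond _ mS) : iQ.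
  suff -> : (EFin \o h) \_ S = EFin \o (h \_ S) by [].
  by apply/funext => u; rewrite /= !patchE; case: ifP.
have [iP ->] := RV_Rintegral mh iQT.
by split => //; rewrite -Rintegral_mkcond.
Qed.

Lemma sample_pair_independent i j (A B : set (k.-tuple R)) : i != j ->
  measurable A -> measurable B ->
  P (y i @^-1` A `&` y j @^-1` B) = (P (y i @^-1` A) * P (y j @^-1` B))%E.
Proof.
move=> ij mA mB.
(* Joint independence is specialized to the indices [i] and [j], with [A] at [i] and [B] at [j]. *)
pose C n := if n == i then A else B.
have mC n : measurable (C n) by rewrite /C; case: ifP.
have /(_ [:: i; j] C) := sample_independent iid.
rewrite /= inE ij => /(_ isT mC).
rewrite !big_cons big_nil mule1 /C eqxx eq_sym (negbTE ij) => <-.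
congr (P _); apply/seteqP; split => [w [wA wB] n /=|w H].
  rewrite !inE => /orP[/eqP ->|/eqP ->]; first by rewrite eqxx.
  by rewrite eq_sym (negbTE ij).
split; first by have := H i; rewrite /= !inE eqxx; apply.
by have := H j; rewrite /= !inE eqxx orbT eq_sym (negbTE ij); apply.
Qed.

(** Pairwise independence and zero mean make the variables [h (y i)] uncorrelated, and their second
    moments share one value, so the strong law above applies. *)
Lemma centered_sample_mean_cvg0 (h : k.-tuple R -> R) :
  integrable_under_g S nu g h ->
  integrable_under_g S nu g (fun u => h u ^+ 2) ->
  expect_g S nu g h = 0 ->
  {ae P, forall w, sample_mean h (y ^~ w) n @[n --> \oo] --> (0 : R)}.
Proof.
move=> ih ih2 h0.
have mh : measurable_fun setT (h \_ S) by have [mh _] := ih; exact/(measurable_restrictT h mS).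
pose X i w := (h \_ S) (y i w).
have mX i : measurable_fun setT (X i) by exact: measurableT_comp.
pose Xm i : {RV P >-> R} := HB.pack (X i) (isMeasurableFun.Build _ _ _ _ _ (mX i)).
have X2E i : (fun w => X i w ^+ 2) = (fun w => ((fun u => h u ^+ 2) \_ S) (y i w)).
  by apply/funext => w; rewrite /X !patchE; case: ifP => // _; rewrite expr0n.
have iX2 i : P.-integrable setT (EFin \o (fun w => X i w ^+ 2)).
  by rewrite X2E; case: (sample_Rintegral i ih2).
have X2v i : \int[P]_w (X i w ^+ 2) <= expect_g S nu g (fun u => h u ^+ 2).
  by have := X2E i => /(congr1 (fun f => \int[P]_w f w)) ->; case: (sample_Rintegral i ih2) => _ ->.
have uncor i j : i != j -> \int[P]_w (X i w * X j w) = 0.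
  move=> ij; apply: (@independent_mean0_mul _ _ _ _ (Xm i) (Xm j)) => /=.
  - move=> A B mA mB.
    apply: (@sample_pair_independent i j ((h \_ S) @^-1` A) ((h \_ S) @^-1` B)) => //.
      by rewrite -[X in measurable X]setTI; exact: mh.
    by rewrite -[X in measurable X]setTI; exact: mh.
  - by case: (sample_Rintegral j ih).
  - by apply: integrable_mul_sq.
  - by rewrite -h0; case: (sample_Rintegral j ih).
have := uncorrelated_strong_law mX iX2 X2v uncor.
apply: filterS => w; rewrite /sample_mean.
suff -> : (fun n => n%:R^-1 * \sum_(i < n) X i w) =
  (fun n => n%:R^-1 * \sum_(i < n) h (y i w)) by [].
apply/funext => n; congr (_ * _); apply: eq_bigr => i _.
by rewrite /X patchE mem_set//; exact: (sample_in_space iid).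
Qed.

End SampleFromDensity.

(** * Population score and curvature at the pseudo-true parameter *)

Section PopulationMoments.
Context (R : realType) (k : nat) (d : measure_display) (W : measurableType d).
Context (P : probability W R) (S : set (k.-tuple R)).
Context (nu : {measure set (k.-tuple R) -> \bar R}) (g : k.-tuple R -> R).
Context (f : k.-tuple R -> R -> R) (Theta Thetac : set R) (thetas : R).
Context (y : nat -> {RV P >-> k.-tuple R}).
Hypothesis iid : iid_with_density S nu g y.
Hypothesis model : model_densities S nu f Theta.
Hypothesis identified : loglik_dominated_KL_identified S nu g f Theta thetas.
Hypothesis score_reg : score_regular S f Theta Thetac.
Hypothesis dominated : derivatives_dominated S nu g f Theta Thetac.
Hypothesis regular : regular_interior_point S nu g f Theta Thetac thetas.
Hypothesis extension : uniform_extension S nu g f Theta Thetac y.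

Let mS := sample_space_measurable iid.
(** All observations have the same density, so expectations under [g] are integrals against the law
    [Q] of the first one, which is a probability measure. *)
Let law0 := @law_integrable_under_g _ _ _ _ _ _ _ _ _ iid 0%N.
Let Q := distribution P (y 0%N).

Lemma loglik_has_deriv u t : S u -> Thetac t ->
  has_deriv_on Thetac (loglik f u) t (score f Thetac u t).
Proof. by move=> Su Dt; exact: (loglik_derivable_c extension Su Dt). Qed.

Lemma score_has_deriv u t : S u -> Thetac t ->
  has_deriv_on Thetac (score f Thetac u) t (score_deriv f Thetac u t).
Proof. by move=> Su Dt; exact: (score_derivable_c extension Su Dt). Qed.

Let Tth : Theta thetas.
Proof. exact: interior_subset (thetas_interior regular). Qed.

Let Tsub : Theta `<=` Thetac := Theta_sub_Thetac extension.

Let m_ln t : Theta t -> measurable_fun S (loglik f ^~ t).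
Proof.
move=> Tt.
exact: measurableT_comp (@measurable_ln R) (model_measurable model Tt).
Qed.

Let i_ln t : Theta t -> Q.-integrable S (EFin \o loglik f ^~ t).
Proof.
move=> Tt; have [m [im mP]] := loglik_dominated identified.
apply: le_integrable_EFin (law0 im).1 => //; first exact: m_ln.
by move=> u Su; case: (mP u t Su Tt).
Qed.

(** Integrability of [ln g] lets the divergence split into a constant minus the expected
    log-likelihood, so minimizing one is maximizing the other. *)
Let max_ln t : Theta t ->
  \int[Q]_(u in S) loglik f u t <= \int[Q]_(u in S) loglik f u thetas.
Proof.
have KLE x : Theta x -> KL_divergence S nu g f x =
    \int[Q]_(u in S) ln (g u) - \int[Q]_(u in S) loglik f u x.
  move=> Tx; have [ig _] := law0 (log_density_integrable identified).
  have [mg _] := log_density_integrable identified.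
  have ix := i_ln Tx.
  rewrite -RintegralB// /KL_divergence /expect_g.
  apply/esym/(law_Rintegral mS (density_measurable iid) (density_ge0 iid)
    (sample_law iid 0%N)).
    by apply: measurable_funB => //; exact: m_ln.
  exact: integrableB_EFin.
move=> Tt.
have : [set thetas] thetas by [].
rewrite -(KL_unique_minimizer identified) => -[_ /(_ t Tt)].
by rewrite !KLE// lerD2l lerN2.
Qed.

Let mds : measurable_fun S (score_deriv f Thetac ^~ thetas).
Proof. by have [[]] := A_pop_defined extension (Tsub Tth). Qed.

Let iD : is_interval Thetac.
Proof. exact: convex_set_is_interval (Thetac_convex extension). Qed.

Lemma score_centered :
  integrable_under_g S nu g (score f Thetac ^~ thetas) /\
  expect_g S nu g (score f Thetac ^~ thetas) = 0.
Proof.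
have [m2 [im2 m2P]] := score_sq_dominated dominated.
have ms := score_measurable score_reg Tth.
have [iQ e] := mean_score_eq0 mS iD Tsub (thetas_interior regular)
  loglik_has_deriv i_ln ms (law0 im2).1 m2P max_ln.
have ig : integrable_under_g S nu g (score f Thetac ^~ thetas).
  split => //; exact: (law_integrableP mS (density_measurable iid)
    (density_ge0 iid) (sample_law iid 0%N) ms).1 iQ.
by split => //; rewrite -e; case: (law0 ig) => _ <-.
Qed.

(** The second-order condition gives nonnegativity, and invertibility of [A_pop] on [Thetac]
    excludes 0. *)
Lemma A_pop_thetas_gt0 : 0 < A_pop S nu g f Thetac thetas.
Proof.
have [m1 [im1 m1P]] := score_deriv_dominated dominated.
have [m2 [im2 m2P]] := score_sq_dominated dominated.
have ms := score_measurable score_reg Tth.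
have le0 := mean_score_deriv_le0 mS iD Tsub (thetas_interior regular)
  loglik_has_deriv score_has_deriv i_ln ms mds (law0 im1).1 (law0 im2).1
  m1P m2P max_ln.
have [ids A0] := A_pop_defined extension (Tsub Tth).
rewrite lt_neqAle eq_sym A0 /= /A_pop oppr_ge0.
by case: (law0 ids) => _ <-.
Qed.

End PopulationMoments.

(** * From a fixed sample to almost every sample *)

Lemma sqrt_B_emp_neq0 (R : realType) (k : nat) (f : k.-tuple R -> R -> R)
    (D : set R) (x : nat -> k.-tuple R) (n : nat) (t : R) :
  B_emp f D x n t != 0 -> Num.sqrt (B_emp f D x n t) != 0.
Proof.
move=> B0; rewrite sqrtr_eq0 -ltNge lt_neqAle eq_sym B0.
by rewrite mulr_ge0 ?invr_ge0// sumr_ge0// => i _; exact: sqr_ge0.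
Qed.

Theorem mainTheorem1
  (R : realType) (k : nat)
  (d : measure_display) (W : measurableType d) (P : probability W R)
  (S : set (k.-tuple R)) (nu : {measure set (k.-tuple R) -> \bar R})
  (g : k.-tuple R -> R) (f : k.-tuple R -> R -> R)
  (Theta Thetac : set R) (thetas alpha : R)
  (y : nat -> {RV P >-> k.-tuple R})
  (thetahat theta1 theta2 : nat -> W -> R) :
  0 < alpha < 1 ->
  iid_with_density S nu g y ->
  model_densities S nu f Theta ->
  loglik_dominated_KL_identified S nu g f Theta thetas ->
  score_regular S f Theta Thetac ->
  derivatives_dominated S nu g f Theta Thetac ->
  regular_interior_point S nu g f Theta Thetac thetas ->
  uniform_extension S nu g f Theta Thetac y ->
  (forall n w, is_max_likelihood f Theta (y ^~ w) n (thetahat n w)) ->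
  {ae P, forall w, \forall n \near \oo,
    solves_pivot_equation f Theta Thetac
      (std_normal_quantile (1 - alpha)) (y ^~ w) n (theta1 n w)} ->
  {ae P, forall w, \forall n \near \oo,
    solves_sandwich_equation f Thetac
      (std_normal_quantile (1 - alpha)) (y ^~ w) n
      (thetahat n w) (theta2 n w)} ->
  {ae P, forall w,
    Num.sqrt n%:R * `|theta1 n w - theta2 n w| @[n --> \oo] --> (0 : R)}.
Proof.
move=> _ iid model identified score_reg dominated regular extension hat_max
  pivot sandwich.
set D := Thetac.
have Tsub : Theta `<=` D := Theta_sub_Thetac extension.
have Tint := thetas_interior regular.
have Tth : Theta thetas by exact: interior_subset Tint.
have Dth : D° thetas by apply: filterS Tint.
have iD : is_interval D by exact: convex_set_is_interval (Thetac_convex extension).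
have dl := loglik_has_deriv extension.
have ds := score_has_deriv extension.
pose Ainv t := (A_pop S nu g f D t)^-1.
pose sB t := Num.sqrt (B_pop S nu g f D t).
have cA : {within D, continuous Ainv} := A_pop_inv_continuous extension.
have cB : {within D, continuous sB} := B_pop_sqrt_continuous extension.
have [c [M [c0 AM]]] : exists c M, 0 < c /\ forall x, D x -> c <= Ainv x <= M.
  apply: (nonvanishing_continuous_bounds (Thetac_compact extension) iD cA
    _ (Tsub _ Tth)).
    by move=> x Dx; rewrite invr_eq0; case: (A_pop_defined extension Dx).
  rewrite invr_gt0.
  exact: (A_pop_thetas_gt0 iid model identified score_reg dominated regular
    extension).
have [b [_ bP]] : exists2 b, b \in D & forall t, t \in D -> sB t <= sB b.
  apply: compact_EVT_max (Thetac_compact extension) cB.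
  by exists thetas; exact: Tsub.
have [is0 s0] := score_centered iid model identified score_reg dominated
  regular extension.
have slln := centered_sample_mean_cvg0 iid is0
  (B_pop_defined extension (Tsub _ Tth)) s0.
have uA := A_inv_uniform_cvg extension.
have uB := B_sqrt_uniform_cvg extension.
(* A sample is fixed in the intersection of five almost sure events: the two uniform convergences,
   the strong law at [thetas], and the two equations. *)
near=> w.
have Sy i : S (y i w) by exact: (sample_in_space iid).
(* The log-likelihood is normalized by [n] so that its derivative is the mean score, and
   [Num.max M (sB b)] serves as common bound for [Ainv] and [sB]. *)
apply: (@pivot_sandwich_cvg R D Theta thetas (std_normal_quantile (1 - alpha))
  (fun n t => n%:R^-1 * \sum_(i < n) loglik f (y i w) t)
  (fun n t => sample_mean (score f D ^~ t) (y ^~ w) n)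
  (fun n t => A_emp f D (y ^~ w) n t)
  (fun n t => Num.sqrt (B_emp f D (y ^~ w) n t)) Ainv sB c (Num.max M (sB b))
  (theta1 ^~ w) (theta2 ^~ w) (thetahat ^~ w)) => //.
- by move=> n x Dx; apply/has_deriv_onZ/has_deriv_on_sum => i; exact: dl.
- move=> n x Dx; rewrite /A_emp opprK.
  by apply/has_deriv_onZ/has_deriv_on_sum => i; exact: ds.
- exact: continuous_interior cA Dth.
- exact: continuous_interior cB Dth.
- by move=> x Dx; have /andP[-> xM] := AM x Dx; rewrite le_max xM.
- move=> x Dx; rewrite ger0_norm ?sqrtr_ge0// le_max.
  by apply/orP; right; apply: bP; rewrite inE.
- by apply: ereal_sup_cvg0_uniform; near: w.
- by apply: ereal_sup_cvg0_uniform; near: w.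
- by near: w.
- move=> n; have [Th hm] := hat_max n w; split => // t Tt.
  by rewrite ler_wpM2l ?invr_ge0// hm.
- have : \forall n \near \oo, solves_pivot_equation f Theta Thetac
      (std_normal_quantile (1 - alpha)) (y ^~ w) n (theta1 n w) by near: w.
  apply: filterS => n [T1 B0 e]; split => //.
  by rewrite sqrt_B_emp_neq0.
- have : \forall n \near \oo, solves_sandwich_equation f Thetac
      (std_normal_quantile (1 - alpha)) (y ^~ w) n
      (thetahat n w) (theta2 n w) by near: w.
  by apply: filterS => n [B0 e]; split => //; rewrite sqrt_B_emp_neq0.
Unshelve. all: by end_near. Qed.
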